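(* Let $n\ge 3$ and $c\ge s\ge 3$ be integers, let $\alpha=\lfloor (n-1)/(c-1)\rfloor$ and $p=n-1-\alpha(c-1)$ (so $0\le p\le c-2$). Let $G$ be a connected graph on $n$ vertices with circumference $c(G)\le c$, and suppose that $N_s(G)=h_s(n,c)$, where $h_s(n,c)=\alpha\binom{c}{s}+\binom{p+1}{s}$. Then: (i) if $s\le p+1$, $G$ is isomorphic to $H_{n,c}$; (ii) otherwise (i.e. if $s\ge p+2$), $L(G,c)$ is a connected graph composed of $\alpha$ blocks each of which is $K_c$, while the remaining blocks are complete graphs.
   Context: All graphs are finite and simple; equality of graphs means isomorphism. $N_s(G)$ denotes the number of $s$-cliques (complete subgraphs on $s$ vertices) of $G$. The circumference $c(G)$ is the length of a longest cycle of $G$. $H_{n,c}$ is the connected graph consisting of $\alpha$ blocks each of which is $K_c$ and one further block which is $K_{p+1}$ (when $p=0$ every block is $K_c$); the number of $s$-cliques of $H_{n,c}$ is $h_s(n,c)$. For a connected graph $G$ with $c(G)\le c$, $L(G,c)$ denotes an edge-maximal graph with respect to $G$ and $c$: a graph on the vertex set $V(G)$ containing $G$ as a spanning subgraph, with $c(L(G,c))\le c$, such that for every non-edge $e$ of $L(G,c)$ we have $c(L(G,c)+e)>c$. *)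

(* Defs.v *)
From mathcomp Require Import all_boot.

Set Implicit Arguments.
Unset Strict Implicit.
Unset Printing Implicit Defensive.

Record sgraph (T : finType) := SGraph {
  adj :> rel T;
  adj_sym : symmetric adj;
  adj_irr : irreflexive adj
}.

Definition isomorphic (T T' : finType) (G : sgraph T) (H : sgraph T') : Prop :=
  exists2 f : T -> T', bijective f & forall x y, H (f x) (f y) = G x y.

Section Graph.
Variables (T : finType) (G : sgraph T).

Definition clique (A : {set T}) : bool :=
  [forall x in A, forall y in A, (x != y) ==> G x y].

Definition is_K (k : nat) (A : {set T}) : bool := (#|A| == k) && clique A.

Definition num_cliques (s : nat) : nat := #|[set A | is_K s A]|.

(* A cycle of length k is a closed walk through k >= 3 distinct vertices;
   the circumference of a forest is 0 by convention. *)
Definition has_cycle (k : nat) : bool :=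
  (2 < k) && [exists t : k.-tuple T, ucycleb G t].

Definition circumference : nat := \max_(k < #|T|.+1 | has_cycle k) k.

Definition connected_in (A : {set T}) : bool :=
  [forall x in A, forall y in A,
     connect [rel u v | [&& u \in A, v \in A & G u v]] x y].

(* The null graph is not considered connected. *)
Definition connected : bool := (0 < #|T|) && connected_in setT.

(* Meant for connected G[A].  If A = [set v] then A :\ v is empty and
   connected_in holds of it, so v is not a cut vertex of K_1. *)
Definition cut_vertex (A : {set T}) (v : T) : bool :=
  (v \in A) && ~~ connected_in (A :\ v).

Definition nonseparable (A : {set T}) : bool :=
  [&& A != set0, connected_in A & [forall v, ~~ cut_vertex A v]].

(* A block is a maximal connected subgraph having no cut vertex of its own.
   Adding edges preserves these two properties, so by maximality a block is an
   induced subgraph, and it is represented here by its vertex set. *)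
Definition blocks : {set {set T}} := [set B | maxset nonseparable B].

Fact add_edge_sym (x y : T) :
  symmetric (fun u v => G u v || (u != v) && ([set u; v] == [set x; y])).
Proof. by move=> u v; rewrite adj_sym eq_sym setUC. Qed.

Fact add_edge_irr (x y : T) :
  irreflexive (fun u v => G u v || (u != v) && ([set u; v] == [set x; y])).
Proof. by move=> u; rewrite adj_irr eqxx. Qed.

(* The graph G + xy (equal to G if x = y). *)
Definition add_edge (x y : T) : sgraph T :=
  SGraph (add_edge_sym x y) (add_edge_irr x y).

End Graph.

Definition edge_maximal (T : finType) (G : sgraph T) (c : nat) (L : sgraph T)
    : Prop :=
  [/\ subrel G L,
      circumference L <= c
    & forall x y, x != y -> ~~ L x y -> c < circumference (add_edge L x y)].

Definition alpha (n c : nat) : nat := (n - 1) %/ (c - 1).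

Definition rest (n c : nat) : nat := n - 1 - alpha n c * (c - 1).

(* The blocks can in general be glued together in several non-isomorphic ways,
   so H_{n,c} is a family of graphs; this says that H belongs to it. *)
Definition is_H (n c : nat) (T : finType) (H : sgraph T) : Prop :=
  connected H /\ #|T| = n /\
  exists A : {set {set T}},
    [/\ #|A| = alpha n c,
        (forall B, B \in A -> is_K H c B)
      & if rest n c == 0 then blocks H = A
        else exists B0, [/\ B0 \notin A, is_K H (rest n c + 1) B0
                          & blocks H = B0 |: A]].

Definition h (s n c : nat) : nat :=
  alpha n c * 'C(c, s) + 'C(rest n c + 1, s).

(* Main.v *)
(** Adding edges, we may assume that G is edge-maximal of circumference at most
    c.  The sum of |B| - 1 over the blocks B is n - 1 and every s-clique lies in
    exactly one block, so, h_s being superadditive in n - 1 (convexity of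
    binomials), it is enough to bound the cliques of one block B.

    If |B| <= c, edge-maximality makes B complete.  If |B| > c, Kopylov's
    argument applies with t = floor(c/2).  Two non-adjacent vertices of the
    (t+1)-core H of B would be the ends of a path on more than c vertices; in a
    longest such path both ends have all their H-neighbours on the path, and a
    2-connected graph containing a path on m vertices whose ends x, y have
    d(x), d(y) neighbours on it has a cycle of length at least
    min(m, d(x) + d(y)).  So H is complete, say on r vertices; the same argument
    shows that H is also the (c+2-r)-core, whence B has at most
    C(r,s) + (|B|-r) C(c+1-r,s-1) s-cliques, which is strictly less than
    h_s(|B|,c) since s >= 3.  An empty core gives a similar bound.

    Equality therefore forces all blocks to be complete on at most c vertices
    and, by strict superadditivity when a carry occurs, exactly alpha of them to
    be K_c.  If s <= p + 1, strict convexity leaves only one other block, and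
    every edge of L(G,c) lies in an s-clique, so that L(G,c) = G. *)

Require Import Defs.
From mathcomp Require Import all_boot zify.

Set Implicit Arguments.
Unset Strict Implicit.
Unset Printing Implicit Defensive.

(** * Paths and connectivity inside a vertex set *)

(* [lia] splits on every boolean atom of the context; the graph facts are dropped first. *)
Ltac arith := intros; repeat match goal with
  | H : is_true (in_mem _ _) |- _ => clear H
  | H : is_true (connected_in _ _) |- _ => clear H
  | H : is_true (~~ in_mem _ _) |- _ => clear H
  | H : is_true (disjoint _ _) |- _ => clear H
  | H : is_true (subset _ _) |- _ => clear H
  | H : is_true (adj _ _ _) |- _ => clear H
  end; lia.

Section Paths.
Variables (T : finType) (G : sgraph T).
Implicit Types (u w x y z : T) (A B S W X Y Z : {set T}).

Definition in_rel A : rel T := [rel u v | [&& u \in A, v \in A & G u v]].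

Lemma connected_inP A :
  reflect {in A &, forall x y, connect (in_rel A) x y} (connected_in G A).
Proof.
apply: (iffP forall_inP) => [h x y xA yA|h x xA].
  by have /forall_inP/(_ _ yA) := h _ xA.
by apply/forall_inP => y yA; exact: h.
Qed.

Lemma in_rel_sub A B : A \subset B -> subrel (in_rel A) (in_rel B).
Proof. by move=> /subsetP sAB u v /and3P[/sAB uB /sAB vB uv]; apply/and3P. Qed.

Lemma connect_in_sub A B x y :
  A \subset B -> connect (in_rel A) x y -> connect (in_rel B) x y.
Proof.
move=> sAB; apply: connect_sub => u v /(in_rel_sub sAB); exact: connect1.
Qed.

Lemma in_rel_connect_sym A : connect_sym (in_rel A).
Proof.
by apply: sym_connect_sym => u v; rewrite /in_rel /= adj_sym andbCA.
Qed.

Lemma connected_in_base A z :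
  (forall x, x \in A -> connect (in_rel A) z x) -> connected_in G A.
Proof.
move=> h; apply/connected_inP => x y xA yA.
by apply: connect_trans (h _ yA); rewrite in_rel_connect_sym h.
Qed.

Lemma connected_in1 u : connected_in G [set u].
Proof. by apply: (@connected_in_base _ u) => x /set1P ->. Qed.

Lemma connected_inU A B u w : connected_in G A -> connected_in G B ->
  u \in A -> w \in B -> (u == w) || G u w -> connected_in G (A :|: B).
Proof.
move=> /connected_inP cA /connected_inP cB uA wB uw.
have uw' : connect (in_rel (A :|: B)) u w.
  case/orP: uw => [/eqP->//|uw]; apply: connect1.
  by rewrite /in_rel /= !inE uA wB uw orbT.
apply: (@connected_in_base _ u) => x /setUP[xA|xB].
  by apply: connect_in_sub (subsetUl _ _) _; exact: cA.
by apply: connect_trans uw' _; apply: connect_in_sub (subsetUr _ _) _; exact: cB.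
Qed.

(** A path is recorded by its vertex set, so that its length is a cardinal and disjoint paths are
    disjoint sets. The order of the vertices stays existential. *)
Definition path_on u w S : Prop :=
  exists q, [/\ path G u q, last u q = w, uniq (u :: q) & S =i u :: q].

Lemma path_on_refl u : path_on u u [set u].
Proof. by exists [::]; split => // x; rewrite !inE. Qed.

Lemma path_on_edge u w : G u w -> path_on u w [set u; w].
Proof.
move=> uw; exists [:: w]; split => //=; first by rewrite uw.
  rewrite andbT inE; apply: contraTneq uw => ->; by rewrite adj_irr.
by move=> x; rewrite !inE.
Qed.

Lemma path_on_endl u w S : path_on u w S -> u \in S.
Proof. by case=> q [_ _ _ ->]; rewrite inE eqxx. Qed.

Lemma path_on_endr u w S : path_on u w S -> w \in S.
Proof. by case=> q [_ <- _ ->]; rewrite mem_last. Qed.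

Lemma path_on_sym u w S : path_on u w S -> path_on w u S.
Proof.
case=> q [pq lq uq eS]; exists (rev (belast u q)).
have E : w :: rev (belast u q) = rev (u :: q).
  by rewrite [u :: q]lastI rev_rcons lq.
split.
- rewrite -lq rev_path; apply: sub_path pq => a b /=; by rewrite adj_sym.
- by case: (q) lq => //= a l _; rewrite rev_cons last_rcons.
- by rewrite E rev_uniq.
- by move=> x; rewrite eS E mem_rev.
Qed.

Lemma path_on_cat u w z S S' : path_on u w S -> path_on w z S' ->
  (forall x, x \in S -> x \in S' -> x = w) -> path_on u z (S :|: S').
Proof.
case=> q [pq lq uq eS] [q' [pq' lq' uq' eS']] d.
exists (q ++ q'); split.
- by rewrite cat_path pq lq pq'.
- by rewrite last_cat lq.
- rewrite -cat_cons cat_uniq uq /=; have /= /andP[wq' ->] := uq'.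
  rewrite andbT; apply/hasPn => x xq'; apply/negP => xq.
  move: wq'; rewrite -(d x) ?xq' // ?eS // eS' inE xq' orbT //.
- move=> x; rewrite -cat_cons mem_cat in_setU eS eS'.
  rewrite [in X in _ || X]inE; case: eqP => [->|] //.
  by rewrite -lq mem_last.
Qed.

(** Both ends are counted in each set, hence the [- 2]. A total above 2 excludes the degenerate case
    of one edge traversed twice. *)
Lemma path_on_cycle u w S S' : path_on u w S -> path_on w u S' -> u != w ->
  (forall x, x \in S -> x \in S' -> x = u \/ x = w) ->
  2 < #|S| + #|S'| - 2 -> has_cycle G (#|S| + #|S'| - 2).
Proof.
case=> q [pq lq uq eS] [q' [pq' lq' uq' eS']] nuw d.
have -> : #|S| = (size q).+1 by rewrite (eq_card eS) (card_uniqP uq).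
have -> : #|S'| = (size q').+1 by rewrite (eq_card eS') (card_uniqP uq').
rewrite addSn addnS subn2 /= => h; rewrite /has_cycle h /=.
apply/existsP.
have sz : size (q ++ q') == size q + size q' by rewrite size_cat.
exists (Tuple sz) => /=; apply/andP; split.
  rewrite (cycle_path u) last_cat lq lq' cat_path pq lq pq' //.
have /= /andP[uNq uq0] := uq; have /= /andP[wNq' uq0'] := uq'.
rewrite cat_uniq uq0 uq0' andbT /=; apply/hasPn => x xq'; apply/negP => xq.
have [||E|E] := d x; rewrite ?eS ?eS' ?inE ?xq ?xq' ?orbT //.
  by rewrite -E xq in uNq.
by rewrite -E xq' in wNq'.
Qed.

Lemma path_on_cycle_edge u w S : path_on u w S -> G u w -> 2 < #|S| ->
  has_cycle G #|S|.
Proof.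
move=> p uw h.
have n : u != w by apply: contraTneq uw => ->; rewrite adj_irr.
have := @path_on_cycle u w S [set w; u] p; rewrite cards2 (eq_sym w) n addnK; apply => //.
  by apply: path_on_edge; rewrite adj_sym.
by move=> x _ /set2P[]; auto.
Qed.

Lemma in_rel_path_subset A u q : path (in_rel A) u q -> u \in A -> {subset u :: q <= A}.
Proof.
elim: q u => [|a q IH] u /=; first by move=> _ uA x; rewrite inE => /eqP->.
case/andP=> /and3P[_ aA _] /IH/(_ aA) h uA x; rewrite inE => /predU1P[->//|]; exact: h.
Qed.

Lemma connect_path_on A u w : u \in A -> connect (in_rel A) u w ->
  exists2 S : {set T}, S \subset A & path_on u w S.
Proof.
move=> uA /connectP[q pq ->]; have [q' pq' uq' _] := shortenP pq.
exists [set x in u :: q'].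
  by apply/subsetP => x; rewrite inE; exact: in_rel_path_subset pq' uA x.
exists q'; split=> //; last by move=> x; rewrite inE.
by apply: sub_path pq' => a b /and3P[].
Qed.

Lemma path_in_rel A u q : path G u q -> {subset u :: q <= A} ->
  path (in_rel A) u q.
Proof.
elim: q u => //= a q IH u /andP[ua pq] s.
apply/andP; split; first by rewrite /in_rel /= ua !s ?inE ?eqxx ?orbT.
apply: IH => // x xq; apply: s.
by rewrite inE xq orbT.
Qed.

Lemma path_on_connected u w S : path_on u w S -> connected_in G S.
Proof.
case=> q [pq _ _ eS]; apply: (@connected_in_base _ u) => x; rewrite eS => xq.
have: path (in_rel S) u q by apply: path_in_rel => // z; rewrite eS.
have /splitPl : x \in u :: q by []. 
case=> p1 p2 <-; rewrite cat_path => /andP[p _]; by apply/connectP; exists p1.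
Qed.

Lemma has_cycle_circ k : has_cycle G k -> k <= circumference G.
Proof.
move=> h; rewrite /circumference.
have lt : k < #|T|.+1.
  case/andP: (h) => _ /existsP[t /andP[_ u]]; rewrite ltnS -(size_tuple t).
  by rewrite -(card_uniqP u) max_card.
exact: (leq_bigmax_cond (Ordinal lt)).
Qed.

Lemma circ_has_cycle c : c < circumference G -> exists2 k, c < k & has_cycle G k.
Proof.
rewrite /circumference => h.
case: (boolP [exists k : 'I_#|T|.+1, (c < k) && has_cycle G k]).
  by case/existsP=> k /andP[]; exists (val k).
rewrite negb_exists => /forallP n; exfalso; move: h; apply/negP; rewrite -leqNgt.
apply/bigmax_leqP => k hk; rewrite leqNgt; have := n k; rewrite hk andbT //.
Qed.

(* S is the set of vertices of a walk from w to a neighbour t of z'. *)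
Lemma bridge D W Z u z : connected_in G D -> u \in D -> u \in W -> z \in D ->
  z \in Z -> [disjoint W & Z] ->
  exists w z' t (S : {set T}), [/\ w \in W, z' \in Z /\ z' \in D, [/\ connected_in G S, w \in S &
    S \subset D],
    (forall x, x \in S -> x \in W -> x = w) /\ (forall x, x \in S -> x \notin Z)
    & t \in S /\ G t z'].
Proof.
move=> /connected_inP cD uD uW zD zZ dWZ.
case/connectP: (cD _ _ uD zD) => q pq lz; rewrite {}lz in zD zZ.
have nW x : x \in W -> x \notin Z by move=> xW; rewrite (disjointFr dWZ xW).
(* While walking from [u] towards [z], [w] is the last vertex of [W] met and [S] the set of vertices
   visited since. [S] restarts at each vertex of [W], and the walk stops on reaching [Z]. *)
suff: forall w (S : {set T}), w \in W -> u \in S -> connected_in G S -> w \in S -> S \subset D ->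
  (forall x, x \in S -> x \in W -> x = w) -> (forall x, x \in S -> x \notin Z) ->
  exists w z' t (S : {set T}), [/\ w \in W, z' \in Z /\ z' \in D, [/\ connected_in G S, w \in S &
    S \subset D],
    (forall x, x \in S -> x \in W -> x = w) /\ (forall x, x \in S -> x \notin Z)
    & t \in S /\ G t z'].
  move/(_ u [set u] uW); apply; rewrite ?set11 ?sub1set ?connected_in1 //.
    by move=> x /set1P.
  by move=> x /set1P ->; exact: nW.
elim: q u pq uD zZ zD {uW} => [|a q IH] u /=.
  by move=> _ _ uZ _ w S _ uS _ _ _ _ /(_ _ uS); rewrite uZ.
case/andP=> /and3P[uD aD ua] pq _ lZ lD w S wW uS cS wS SD SW SZ.
have [aZ|aNZ] := boolP (a \in Z).
  by exists w, a, u, S; split.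
have [aW|aNW] := boolP (a \in W).
  apply: (IH a pq aD lZ lD a [set a]); rewrite ?set11 ?connected_in1 ?sub1set //.
    by move=> x /set1P.
  by move=> x /set1P->.
apply: (IH a pq aD lZ lD w (S :|: [set a])) => //; rewrite ?inE ?eqxx ?wS ?orbT //.
- by apply: (connected_inU cS (connected_in1 a) uS (set11 a)); rewrite ua orbT.
- by rewrite subUset SD sub1set.
- by move=> x /setUP[/SW//|/set1P->]; rewrite (negPf aNW).
- by move=> x /setUP[/SZ//|/set1P->].
Qed.

End Paths.

(** * Two disjoint connections between the ends of a path *)

Section Kopylov.
Variables (T : finType) (G : sgraph T).
Implicit Types (u w x y z : T) (B S X Y : {set T}).

Lemma disjoint_setUl X Y S : [disjoint X & S] -> [disjoint Y & S] ->
  [disjoint X :|: Y & S].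
Proof. by rewrite -!setI_eq0 setIUl setU_eq0 => -> ->. Qed.

Lemma disjoint_setUr X Y S : [disjoint S & X] -> [disjoint S & Y] ->
  [disjoint S & X :|: Y].
Proof. by rewrite -!setI_eq0 setIUr setU_eq0 => -> ->. Qed.

(** Chords and detours are compared by positions, which [path_on] hides. Only the values of [v]
    below [m] matter. *)
Definition indexed_path (v : nat -> T) m : Prop :=
  (forall i j, i < m -> j < m -> v i = v j -> i = j) /\
  (forall i, i.+1 < m -> G (v i) (v i.+1)).

Definition seg (v : nat -> T) i j : {set T} :=
  [set x in [seq v k | k <- iota i (j.+1 - i)]].

Lemma segP v i j x : reflect (exists2 k, i <= k <= j & x = v k) (x \in seg v i j).
Proof.
rewrite inE; apply: (iffP mapP) => -[k kij ->]; exists k => //.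
  by move: kij; rewrite mem_iota; arith.
by rewrite mem_iota; arith.
Qed.

Lemma mem_seg v i j k : i <= k <= j -> v k \in seg v i j.
Proof. by move=> h; apply/segP; exists k. Qed.

Lemma seg1 v i : seg v i i = [set v i].
Proof.
apply/setP => x; apply/segP/set1P => [[k ki ->]|->]; last by exists i; rewrite ?leqnn.
by congr v; arith.
Qed.

Lemma path_on_seg v m i j : indexed_path v m -> i <= j < m -> path_on G (v i) (v j) (seg v i j).
Proof.
case=> vinj vadj; elim: j => [|j IH] ij.
  have -> : i = 0 by arith.
  by rewrite seg1; exact: path_on_refl.
have [->|ne] := eqVneq i j.+1; first by rewrite seg1; exact: path_on_refl.
have -> : seg v i j.+1 = seg v i j :|: [set v j; v j.+1].
  apply/setP => x; apply/segP/idP => [[k kij ->]|].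
    rewrite in_setU in_set2; have [->|n] := eqVneq k j.+1; first by rewrite eqxx !orbT.
    by rewrite mem_seg //; arith.
  case/setUP => [/segP[k kij ->]|/set2P[->|->]]; [exists k|exists j|exists j.+1] => //; arith.
apply: path_on_cat (IH _) (path_on_edge (vadj _ _)) _; try arith.
move=> x /segP[k kij ->] /set2P[] // /vinj E; arith.
Qed.

Lemma card_seg v m i j : indexed_path v m -> j < m -> #|seg v i j| = j.+1 - i.
Proof.
case=> vinj _ jm; rewrite cardsE; have /card_uniqP -> : uniq [seq v k | k <- iota i (j.+1 - i)].
  rewrite map_inj_in_uniq ?iota_uniq // => a b; rewrite !mem_iota => ha hb; apply: vinj; arith.
by rewrite size_map size_iota.
Qed.

Lemma indexed_path_rev v m : indexed_path v m -> indexed_path (fun k => v (m.-1 - k)) m.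
Proof.
case=> vinj vadj; split=> [i j im jm /vinj E|i im]; first arith.
by rewrite adj_sym (_ : m.-1 - i = (m.-1 - i.+1).+1); [apply: vadj|]; arith.
Qed.

Lemma seg_rev v m i j : i <= j < m ->
  seg (fun k => v (m.-1 - k)) (m.-1 - j) (m.-1 - i) = seg v i j.
Proof.
move=> h; apply/setP => x; apply/segP/segP => -[k kij ->].
  by exists (m.-1 - k) => //; arith.
exists (m.-1 - k); first arith.
by congr v; arith.
Qed.

Definition deg_in x S := #|[set y in S | G x y]|.

Lemma deg_in_sub x S S' : S \subset S' -> deg_in x S <= deg_in x S'.
Proof.
move=> /subsetP s; apply/subset_leq_card/subsetP => y; rewrite !inE.
by case/andP=> /s -> ->.
Qed.

(* The path v_p, ..., v_0, v_k, ..., v_a, where v_k is the first neighbour of v_0 after v_p. *)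
Lemma end_detour v m a p : indexed_path v m -> p < a < m -> G (v 0) (v a) ->
  exists S, [/\ S \subset seg v 0 a, path_on G (v p) (v a) S &
    deg_in (v 0) (seg v 0 a) < #|S|].
Proof.
move=> vp ha Ga.
have ex : exists k, (p < k) && G (v 0) (v k) by exists a; rewrite Ga; arith.
case: (ex_minnP ex) => k /andP[pk Gk] kmin.
have ka : k <= a by apply: kmin; rewrite Ga; arith.
have [vinj vadj] := vp.
exists (seg v 0 p :|: seg v k a); split.
- by apply/subsetP => x /setUP[] /segP[l h ->]; apply: mem_seg; arith.
- have -> : seg v 0 p :|: seg v k a = seg v 0 p :|: ([set v 0; v k] :|: seg v k a).
    apply/setP => x; rewrite !in_setU !in_set1.
    case: eqP => [->|_]; first by rewrite mem_seg.
    case: eqP => [->|_] //=; rewrite [v k \in seg v k a]mem_seg ?orbT //; arith.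
  apply: (path_on_cat (path_on_sym (path_on_seg vp _))); first arith.
  - apply: (path_on_cat (path_on_edge Gk) (path_on_seg vp _)); first arith.
    by move=> x /set2P[]-> // /segP[l hl /vinj]; arith.
  move=> x /segP[l hl ->] /setUP[/set2P[]//|/segP[l' hl']] /vinj; arith.
rewrite /deg_in; have v0 : v 0 \notin [set y in seg v 0 a | G (v 0) y].
  by rewrite inE adj_irr andbF.
have := cardsU1 (v 0) [set y in seg v 0 a | G (v 0) y]; rewrite v0 add1n => <-.
apply/subset_leq_card/subsetP => x /setU1P[->|]; first by rewrite in_setU mem_seg.
rewrite inE => /andP[/segP[l hl ->] Gl]; rewrite in_setU.
have [lp|lp] := leqP l p; first by rewrite mem_seg.
have kl : k <= l by rewrite kmin // lp.
by rewrite (@mem_seg v k a) ?orbT //; arith.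
Qed.

Section TwoPaths.
Variables (v : nat -> T) (m a b : nat) (B : {set T}).
Hypotheses (vp : indexed_path v m) (vB : forall k, k < m -> v k \in B).
Hypotheses (cB : forall z, connected_in G (B :\ z)).
Hypotheses (a0 : 0 < a) (ab : a <= b) (bm : b.+1 < m).

(* The connections start at v_a and at some earlier vertex, in either order. *)
Let good s1 s2 := ((s1 == a) && (s2 < a)) || ((s2 == a) && (s1 < a)).

(** Connected sets are carried along instead of paths; paths are extracted only once both sets are
    complete. They meet the outer segments of the path in [v s] and [v e] only. *)
Definition linked s e X : Prop :=
  [/\ connected_in G X, v s \in X, v e \in X,
    (forall k, k <= a -> v k \in X -> k = s)
    & (forall k, b <= k < m -> v k \in X -> k = e)].

Definition two_paths : Prop := exists s1 s2 r X1 X2,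
  [/\ good s1 s2, b < r < m, [disjoint X1 & X2], linked s1 b X1 & linked s2 r X2].

Definition reaches q s X : Prop :=
  [/\ connected_in G X, v s \in X, (forall k, k <= a -> v k \in X -> k = s),
    (forall k, q <= k < m -> v k \notin X) & (exists2 u, u \in X & G u (v q))].

(* Both connections stop just before v_q; pushing q beyond b yields [two_paths]. *)
Definition state q : Prop := a < q <= b /\ exists s1 s2 X1 X2,
  [/\ good s1 s2, [disjoint X1 & X2], reaches q s1 X1 & reaches q s2 X2].

(** [Y1] has arrived at [v q] and [Y2] at a neighbour of [v q']. If [q' <= b], [Y1] follows the path
    until just before [v q'], so that both sets stop there. Otherwise [Y1] follows it to [v b], and
    [Y2] takes in [v q'], which lies beyond [v b]. *)
Lemma advance q q' s1 s2 Y1 Y2 : good s1 s2 -> [disjoint Y1 & Y2] ->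
  a <= q <= b -> q < q' < m ->
  connected_in G Y1 -> v s1 \in Y1 -> v q \in Y1 ->
  (forall k, k <= a -> v k \in Y1 -> k = s1) ->
  (forall k, q < k < m -> v k \notin Y1) ->
  connected_in G Y2 -> v s2 \in Y2 -> (forall k, k <= a -> v k \in Y2 -> k = s2) ->
  (forall k, q <= k < m -> v k \notin Y2) -> (exists2 u, u \in Y2 & G u (v q')) ->
  (q' <= b /\ state q') \/ two_paths.
Proof.
have [vinj vadj] := vp.
move=> g d aqb qq' c1 s1Y qY A1 N1 c2 s2Y A2 N2 [u uY uq'].
have dseg j : j < m -> [disjoint seg v q j & Y2].
  move=> jm; apply/pred0P => x /=; apply/negP => /andP[/segP[k hk ->]].
  by apply/negP; apply: N2; arith.
have cseg j : q <= j < m -> connected_in G (Y1 :|: seg v q j).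
  move=> h; apply: (connected_inU c1 (path_on_connected (path_on_seg vp h)) qY (w := v q)).
    by rewrite mem_seg; arith.
  by rewrite eqxx.
have Aseg j k : j < m -> k <= a -> v k \in Y1 :|: seg v q j -> k = s1.
  move=> jm ka /setUP[/A1->//|/segP[l hl /vinj E]].
  have kq : k = q by arith.
  by apply: A1 => //; rewrite kq.
have [q'b|q'b] := leqP q' b; [left|right].
  split=> //; split; first arith.
  exists s1, s2, (Y1 :|: seg v q q'.-1), Y2; split => //.
  - by apply: disjoint_setUl => //; apply: dseg; arith.
  - split; rewrite ?in_setU ?s1Y //.
    + by apply: cseg; arith.
    + by move=> k; apply: Aseg; arith.
    + move=> k hk; apply/negP => /setUP[|/segP[l hl /vinj E]]; last arith.
      by apply/negP/N1; arith.
    + exists (v q'.-1); first by rewrite in_setU mem_seg ?orbT //; arith.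
      by rewrite -[in v q'](prednK (n := q')); [apply: vadj|]; arith.
  - by split => //; [move=> k hk; apply: N2; arith | exists u].
exists s1, s2, q', (Y1 :|: seg v q b), (Y2 :|: [set v q']); split => //; first arith.
- apply: disjoint_setUr.
    by apply: disjoint_setUl => //; apply: dseg; arith.
  rewrite disjoint_sym disjoints1; apply/negP => /setUP[|/segP[l hl /vinj E]]; last arith.
  by apply/negP/N1; arith.
- split; rewrite ?in_setU ?s1Y //.
  + by apply: cseg; arith.
  + by rewrite mem_seg ?orbT //; arith.
  + by move=> k; apply: Aseg; arith.
  + move=> k hk /setUP[|/segP[l hl /vinj E]]; last arith.
    have [->|n] := eqVneq k b; first by [].
    by move=> h; have /negP[] : v k \notin Y1 by apply: N1; arith.
- split; rewrite ?inE ?s2Y ?eqxx ?orbT //.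
  + apply: (connected_inU c2 (connected_in1 G (v q')) uY (set11 _)).
    by rewrite uq' orbT.
  + by move=> k ka /setUP[/A2->//|/set1P/vinj]; arith.
  + move=> k hk /setUP[h|/set1P/vinj]; last arith.
    by have /negP[] : v k \notin Y2 by apply: N2; arith.
Qed.

(** As [B :\ v a] is connected, a bridge leads from the part of the path before [v a] to the part
    after it. It is the second set; the first is the singleton of [v a]. *)
Lemma init_state : (exists q, state q) \/ two_paths.
Proof.
have [vinj vadj] := vp.
have inD k : k < m -> k != a -> v k \in B :\ v a.
  move=> km ka; rewrite !inE vB // andbT; apply: contraNneq ka => /vinj E.
  by apply/eqP; arith.
have dis : [disjoint seg v 0 a.-1 & seg v a.+1 m.-1].
  apply/pred0P => x /=; apply/negP => /andP[/segP[k hk ->]] /segP[l hl /vinj]; arith.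
have [w [z' [t [S [wW [zZ zD] [cS wS SD] [SW SZ] [tS tz]]]]]] :=
  @bridge _ G _ (seg v 0 a.-1) (seg v a.+1 m.-1) (v 0) (v a.+1) (cB (v a))
   (inD 0 ltac:(arith) ltac:(arith)) (@mem_seg v 0 a.-1 0 ltac:(arith))
   (inD a.+1 ltac:(arith) ltac:(arith))
   (@mem_seg v a.+1 m.-1 a.+1 ltac:(arith)) dis.
case/segP: zZ => q' hq' Ez; subst z'.
case/segP: wW => p hp Ew; subst w.
have aS : v a \notin S.
  by apply/negP => /(subsetP SD); rewrite !inE eqxx.
have := @advance a q' a p [set v a] S; case => //.
- by rewrite /good; arith.
- by rewrite disjoints1.
- arith.
- arith.
- exact: connected_in1.
- by rewrite inE.
- by rewrite inE.
- by move=> k ka /set1P/vinj; arith.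
- by move=> k hk; apply/negP => /set1P/vinj; arith.
- move=> k ka kS.
  have nka : k != a by apply: contraNneq aS => <-.
  have /vinj : v k = v p by apply: SW kS _; apply: mem_seg; arith.
  arith.
- move=> k hk; have [->//|n] := eqVneq k a.
  by apply: (contraL (SZ _)); apply: mem_seg; arith.
- by exists t.
- by case=> _ st; left; exists q'.
- by right.
Qed.

(** In [B :\ v q] a bridge leads past [v q]. If it leaves from [X1] or [X2], it prolongs that set;
    if it leaves from elsewhere on the initial segment, it starts a new one. The set that is kept
    unbridged takes in [v q]. *)
Lemma next_state q : state q -> (exists2 q', q < q' & state q') \/ two_paths.
Proof.
have [vinj vadj] := vp.
case=> aqb [s1 [s2 [X1 [X2 [g d [c1 v1 A1 N1 [u1 u1X u1q]] [c2 v2 A2 N2 [u2 u2X u2q]]]]]]].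
have inD k : k < m -> k != q -> v k \in B :\ v q.
  move=> km ka; rewrite !inE vB // andbT; apply: contraNneq ka => /vinj E.
  by apply/eqP; arith.
set W := seg v 0 a :|: (X1 :|: X2).
have dis : [disjoint W & seg v q.+1 m.-1].
  apply/pred0P => x /=; apply/negP => /andP[xW /segP[k hk Ek]]; subst x.
  case/setUP: xW => [/segP[l hl /vinj]|/setUP[]]; first arith.
    by apply/negP/N1; arith.
  by apply/negP/N2; arith.
have W0 : v 0 \in W by rewrite in_setU mem_seg.
have [w [z' [t [S [wW [zZ zD] [cS wS SD] [SW SZ] [tS tz]]]]]] :=
  @bridge _ G _ W (seg v q.+1 m.-1) (v 0) (v q.+1) (cB (v q))
   (inD 0 ltac:(arith) ltac:(arith)) W0 (inD q.+1 ltac:(arith) ltac:(arith))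
   (@mem_seg v q.+1 m.-1 q.+1 ltac:(arith)) dis.
have qS : v q \notin S.
  by apply/negP => /(subsetP SD); rewrite !inE eqxx.
have SN k : q <= k < m -> v k \notin S.
  move=> hk; have [->//|n] := eqVneq k q.
  by apply: (contraL (SZ _)); apply: mem_seg; arith.
have SA k : k <= a -> v k \in S -> v k = w.
  by move=> ka kS; apply: SW => //; rewrite in_setU mem_seg.
case/segP: zZ => q' hq' Ez; subst z'.
(* X1 and X2 play symmetric roles: X1 is extended by v_q and X2 by the bridge. *)
have step s s' X X' Y : good s s' -> [disjoint X & X'] -> reaches q s X ->
   connected_in G Y -> v s' \in Y -> [disjoint X & Y] -> v q \notin Y ->
   t \in Y -> (forall k, k <= a -> v k \in Y -> k = s') ->
   (forall k, q <= k < m -> v k \notin Y) ->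
   (exists2 q', q < q' & state q') \/ two_paths.
  move=> gs dX [c vs Ax Nx [u uX uq]] cY vY dXY qY tY AY NY.
  have := @advance q q' s s' (X :|: [set v q]) Y; case => //.
  - by apply: disjoint_setUl; rewrite ?disjoints1.
  - arith.
  - arith.
  - by apply: (connected_inU c (connected_in1 G (v q)) uX (set11 _)); rewrite uq orbT.
  - by rewrite inE vs.
  - by rewrite !inE eqxx orbT.
  - by move=> k ka /setUP[/Ax->//|/set1P/vinj]; arith.
  - move=> k hk; apply/negP => /setUP[|/set1P/vinj]; last arith.
    by apply/negP/Nx; arith.
  - by exists t.
  - by case=> _ st; left; exists q' => //; arith.
  - by right.
have disj X : [disjoint X & S] <-> (forall x, x \in X -> x \notin S).
  split; first by move=> dX x xX; rewrite (disjointFr dX).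
  by move=> h; apply/pred0P => x /=; apply/negP => /andP[/h/negP].
have XW x : x \in X1 \/ x \in X2 -> x \in W by rewrite !in_setU => -[] ->; rewrite ?orbT.
have dw x : x \in X1 -> x \in X2 -> False.
  by move=> x1; rewrite (disjointFr d x1).
have case_in s s' X X' : good s s' -> [disjoint X & X'] ->
   (forall x, x \in X \/ x \in X' -> x \in W) -> reaches q s X -> reaches q s' X' -> w \in X' ->
   (exists2 q', q < q' & state q') \/ two_paths.
  move=> gs dX sW rX [c vs Ax Nx [u uX uq]] wX'.
  apply: (step s s' X X' (X' :|: S)) => //.
  - by apply: (connected_inU c cS wX' wS); rewrite eqxx.
  - by rewrite inE vs.
  - apply: disjoint_setUr => //; apply/disj => x xX; apply/negP => xS.
    have E : x = w by apply: SW => //; apply: sW; left.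
    by rewrite -E (disjointFr dX xX) in wX'.
  - by rewrite inE (negPf qS) orbF Nx //; arith.
  - by rewrite inE tS orbT.
  - move=> k ka /setUP[/Ax->//|/(SA _ ka) E]; apply: Ax => //; by rewrite E.
  - by move=> k hk; rewrite inE negb_or Nx // SN.
have r1 : reaches q s1 X1 by split=> //; exists u1.
have r2 : reaches q s2 X2 by split=> //; exists u2.
have g' : good s2 s1 by rewrite /good orbC.
have d' : [disjoint X2 & X1] by rewrite disjoint_sym.
have [w1|w1] := boolP (w \in X1).
  by apply: (case_in s2 s1 X2 X1) => // x; rewrite or_comm; exact: XW.
have [w2|w2] := boolP (w \in X2).
  by apply: (case_in s1 s2 X1 X2).
have /segP[p hp Ew] : w \in seg v 0 a by move: wW; rewrite !in_setU (negPf w1) (negPf w2) !orbF.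
subst w.
have dX X : (forall x, x \in X -> x \in W) -> v p \notin X -> [disjoint X & S].
  move=> sW pX; apply/disj => x xX; apply/negP => xS.
  by have E : x = v p by [apply: SW => //; apply: sW]; rewrite -E xX in pX.
have pX s X : reaches q s X -> v p \notin X -> p != s.
  by case=> _ vs _ _ _; apply: contraNneq => ->.
have p1 := pX _ _ r1 w1; have p2 := pX _ _ r2 w2.
have AS k : k <= a -> v k \in S -> k = p by move=> ka /(SA _ ka)/vinj; arith.
(* The set starting at [v a] is kept, and the bridge, which starts earlier, replaces the other one.
   This preserves [good]. *)
have [ea|na] := eqVneq s1 a.
  apply: (step s1 p X1 S S) => //; first by move: g; rewrite /good; arith.
    by apply: dX w1 => x; auto.
  by apply: dX w1 => x; auto.
apply: (step s2 p X2 S S) => //; first by move: g; rewrite /good; arith.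
  by apply: dX w2 => x; auto.
by apply: dX w2 => x; auto.
Qed.

(** The position [q] increases but stays at most [b], so the process ends. This is a two-path form
    of Menger's theorem in which one start, [v a], and one end, [v b], are prescribed. *)
Lemma two_pathsP : two_paths.
Proof.
case: init_state => [[q]|//].
move: {2}(m - q) (leqnn (m - q)) => n; elim: n q => [|n IH] q hn st.
  by case: st; arith.
case: (next_state st) => [[q' qq' st']|//]; apply: (IH q') => //.
by case: st' => h _; arith.
Qed.

End TwoPaths.
End Kopylov.

(** * Long cycles from paths with end vertices of large degree *)

Section Kopylov.
Variables (T : finType) (G : sgraph T).
Implicit Types (u w x y z : T) (B S X Y : {set T}).

(** For crossing chords with [j - i] minimal, the cycle runs from [v 0] to [v i], jumps to [v m.-1],
    and goes back to [v j] and [v 0]. By minimality it skips no neighbour of either end, which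
    bounds its length below by the degree sum. *)
Lemma crossing_cycle v m c : indexed_path G v m -> 2 <= c -> c < m ->
  c < deg_in G (v 0) (seg v 0 m.-1) + deg_in G (v m.-1) (seg v 0 m.-1) ->
  (exists i j, [/\ i < j < m, G (v 0) (v j) & G (v m.-1) (v i)]) ->
  exists2 k, c < k & has_cycle G k.
Proof.
move=> vp c2 cm hd [i0 [j0 [ij0 Gj0 Gi0]]]; have [vinj vadj] := vp.
have ex : exists d, [exists i : 'I_m, exists j : 'I_m,
    [&& i < j, j - i == d, G (v 0) (v j) & G (v m.-1) (v i)]].
  have hi : i0 < m by arith.
  have hj : j0 < m by arith.
  exists (j0 - i0); apply/existsP; exists (Ordinal hi); apply/existsP; exists (Ordinal hj) => /=.
  by rewrite Gj0 Gi0 eqxx; arith.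
case: (ex_minnP ex) => d /existsP[[i im] /existsP[[j jm] /= /and4P[ij /eqP jid Gj Gi]]] dmin.
have {}dmin i' j' : i' < j' < m -> G (v 0) (v j') -> G (v m.-1) (v i') -> d <= j' - i'.
  move=> h Gj' Gi'; apply: dmin.
  have hi : i' < m by arith.
  have hj : j' < m by arith.
  apply/existsP; exists (Ordinal hi); apply/existsP; exists (Ordinal hj) => /=.
  by rewrite Gj' Gi' eqxx; arith.
set S := seg v 0 i :|: seg v j m.-1.
have cS : #|S| = i.+1 + (m - j).
  rewrite cardsU !(card_seg _ vp) //; try arith.
  suff -> : seg v 0 i :&: seg v j m.-1 = set0 by rewrite cards0; arith.
  by apply/setP => x; rewrite in_setI in_set0; apply/negP =>
    /andP[/segP[k hk ->] /segP[l hl /vinj]]; arith.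
have pS : path_on G (v 0) (v j) S.
  have -> : S = seg v 0 i :|: ([set v i; v m.-1] :|: seg v j m.-1).
    apply/setP => x; rewrite !in_setU !in_set1.
    case: eqP => [->|_]; first by rewrite mem_seg //; arith.
    by case: eqP => [->|_] //=; rewrite [v m.-1 \in seg v j _]mem_seg ?orbT //; arith.
  apply: (path_on_cat (path_on_seg vp _)); first arith.
  - apply: (path_on_cat (path_on_edge _) (path_on_sym (path_on_seg vp _))).
    + by rewrite adj_sym.
    + by arith.
    + by move=> x /set2P[]-> // /segP[l hl /vinj]; arith.
  by move=> x /segP[l hl ->] /setUP[/set2P[]//|/segP[l' hl']] /vinj; arith.
(* For consecutive [i] and [j] nothing is skipped and the cycle has [m] vertices. *)
have [E|nE] := eqVneq j i.+1.
  by exists #|S|; [arith | apply: path_on_cycle_edge pS Gj _; arith].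
suff h : c < #|S| by exists #|S| => //; apply: path_on_cycle_edge pS Gj _; arith.
apply: (leq_trans hd); rewrite cS.
(* Neighbours of [v 0] are shifted to their predecessors. As the minimal [j - i] exceeds 1, no
   predecessor is a neighbour of [v m.-1], so the two degrees add up. *)
pose Ix := [set k : 'I_m | (k.+1 < m) && G (v 0) (v k.+1)].
pose Iy := [set k : 'I_m | G (v m.-1) (v k)].
have bx : deg_in G (v 0) (seg v 0 m.-1) <= #|Ix|.
  apply: leq_trans (leq_imset_card (fun k : 'I_m => v k.+1) Ix).
  apply/subset_leq_card/subsetP => x; rewrite inE => /andP[/segP[k hk ->] Gk].
  have k0 : k != 0 by apply: contraTneq Gk => ->; rewrite adj_irr.
  have hk' : k.-1 < m by arith.
  have E : (k.-1).+1 = k by arith.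
  apply/imsetP; exists (Ordinal hk'); rewrite ?inE /= E // Gk andbT; arith.
have byy : deg_in G (v m.-1) (seg v 0 m.-1) <= #|Iy|.
  apply: leq_trans (leq_imset_card (fun k : 'I_m => v k) Iy).
  apply/subset_leq_card/subsetP => x; rewrite inE => /andP[/segP[k hk ->] Gk].
  have hk' : k < m by arith.
  by apply/imsetP; exists (Ordinal hk'); rewrite ?inE.
apply: (leq_trans (leq_add bx byy)).
have <- : #|Ix :|: Iy| = #|Ix| + #|Iy|.
  apply/eqP; rewrite (leq_card_setU Ix Iy).2; apply/pred0P => k /=; apply/negP.
  by rewrite !inE => /andP[/andP[km Gx] Gy]; have := dmin k k.+1 _ Gx Gy; arith.
have <- : #|[set v (k : 'I_m) | k in Ix :|: Iy]| = #|Ix :|: Iy|.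
  by apply: card_in_imset => k l _ _ /vinj E; apply/val_inj/E.
(* The second segment is the shift of [v j], ..., [v m.-1] and has the same size. *)
apply: (@leq_trans #|seg v 0 i :|: seg v j.-1 m.-2|).
  apply/subset_leq_card/subsetP => x /imsetP[k kI ->]; rewrite in_setU.
  have km := ltn_ord k.
  have [ki|ki] := leqP k i; first by rewrite mem_seg.
  rewrite (@mem_seg _ v j.-1) ?orbT //.
  move: kI; rewrite !inE => /orP[/andP[km' Gk]|Gk].
    by have := dmin i k.+1 _ Gk Gi; arith.
  have nk : nat_of_ord k != m.-1 by apply: contraTneq Gk => ->; rewrite adj_irr.
  by have := dmin k j _ Gj Gk; arith.
rewrite (leq_trans (leq_card_setU _ _)) // !(card_seg _ vp); arith.
Qed.

(** Let [v a] be the last neighbour of [v 0] and [v b] the first one of [v m.-1]. The cycle consists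
    of a detour at each end and two disjoint links between them. Each detour has more vertices than
    the degree of its end vertex. *)
Lemma noncrossing_cycle v m B c : indexed_path G v m -> (forall k, k < m -> v k \in B) ->
  (forall z, connected_in G (B :\ z)) -> 2 <= c -> c < m ->
  c < deg_in G (v 0) (seg v 0 m.-1) + deg_in G (v m.-1) (seg v 0 m.-1) ->
  (forall i j, i < j < m -> G (v 0) (v j) -> G (v m.-1) (v i) -> False) ->
  exists2 k, c < k & has_cycle G k.
Proof.
move=> vp vB cB c2 cm hd nocross; have [vinj vadj] := vp.
have exa : exists k, (k < m) && G (v 0) (v k) by exists 1; rewrite vadj; arith.
have exb : exists k, (k < m) && G (v m.-1) (v k).
  exists m.-2; rewrite adj_sym (_ : m.-1 = m.-2.+1) ?vadj; arith.
have ubd k : (k < m) && G (v 0) (v k) -> k <= m by arith.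
case: (ex_maxnP exa ubd) => a /andP[am Ga] amax.
case: (ex_minnP exb) => b /andP[bm Gb] bmin.
have a0 : 0 < a by rewrite lt0n; apply: contraTneq Ga => ->; rewrite adj_irr.
have b1 : b.+1 < m.
  have : b != m.-1 by apply: contraTneq Gb => ->; rewrite adj_irr.
  arith.
have ab : a <= b by rewrite leqNgt; apply/negP => h; apply: (nocross b a); rewrite ?h ?am.
have [s1 [s2 [r [X1 [X2 [g hr d [c1 v1 e1 A1 B1] [c2' v2 e2 A2 B2]]]]]]] :=
  two_pathsP vp vB cB a0 ab b1.
have [S1 sS1 p1] : exists2 S : {set T}, S \subset X1 & path_on G (v s1) (v b) S.
  by apply: connect_path_on => //; move/connected_inP: c1; apply.
have [S2 sS2 p2] : exists2 S : {set T}, S \subset X2 & path_on G (v r) (v s2) S.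
  by apply: connect_path_on => //; move/connected_inP: c2'; apply.
have [SA [sSA pA cA]] : exists S, [/\ S \subset seg v 0 a, path_on G (v s2) (v s1) S &
    deg_in G (v 0) (seg v 0 a) < #|S|].
  case/orP: g => /andP[/eqP es hs].
    have [S [? ? ?]] := @end_detour _ G v m a s2 vp ltac:(arith) Ga.
    by exists S; rewrite es.
  have [S [? pS ?]] := @end_detour _ G v m a s1 vp ltac:(arith) Ga.
  by exists S; rewrite es; split => //; apply: path_on_sym.
have [SB [sSB pB cB']] : exists S, [/\ S \subset seg v b m.-1, path_on G (v b) (v r) S &
    deg_in G (v m.-1) (seg v b m.-1) < #|S|].
  (* On the reversed path [v b] has position [m.-1 - b] and [v r] has position [m.-1 - r]. *)
  have [|/=|S [sS pS hS]] := @end_detour _ G _ m (m.-1 - b) (m.-1 - r) (indexed_path_rev vp); first arith.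
    by rewrite subn0 (_ : m.-1 - (m.-1 - b) = b) //; arith.
  have E := @seg_rev _ v m b m.-1 ltac:(arith).
  rewrite subnn in E; rewrite E /= subn0 in sS hS.
  have E1 : m.-1 - (m.-1 - b) = b by arith.
  have E2 : m.-1 - (m.-1 - r) = r by arith.
  by exists S; split => //; apply: path_on_sym; move: pS; rewrite E1 E2.
have na : deg_in G (v 0) (seg v 0 m.-1) <= deg_in G (v 0) (seg v 0 a).
  apply/subset_leq_card/subsetP => x /setIdP[/segP[k hk ->] Gk].
  by apply/setIdP; split=> //; apply: mem_seg; rewrite /= amax // Gk; arith.
have nbb : deg_in G (v m.-1) (seg v 0 m.-1) <= deg_in G (v m.-1) (seg v b m.-1).
  apply/subset_leq_card/subsetP => x /setIdP[/segP[k hk ->] Gk].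
  have kb : b <= k by apply: bmin; rewrite Gk; arith.
  by apply/setIdP; split=> //; apply: mem_seg; arith.
have dAB x : x \in SA -> x \in SB -> x = v b.
  move=> /(subsetP sSA)/segP[k hk ->] /(subsetP sSB)/segP[l hl] E.
  by congr v; move: E => /vinj; arith.
have p3 : path_on G (v s2) (v r) (SA :|: S1 :|: SB).
  apply: path_on_cat pB _.
    apply: (path_on_cat pA p1) => x /(subsetP sSA)/segP[k hk ->] /(subsetP sS1) h.
    by congr v; apply: A1 => //; arith.
  move=> x /setUP[|/(subsetP sS1) h]; first exact: dAB.
  move=> /(subsetP sSB)/segP[k hk E]; subst x.
  by congr v; apply: B1 => //; arith.
have s2a : s2 <= a by case/orP: g => /andP[]; arith.
have nrs : v s2 != v r by apply/eqP => /vinj; arith.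
(* The detours overlap at most in [v b], and only if [a = b]. *)
have h1 : #|SA| + #|SB| <= #|SA :|: S1 :|: SB|.+1.
  have -> : #|SA| + #|SB| = #|SA :|: SB| + #|SA :&: SB| by rewrite cardsUI.
  rewrite -addn1 leq_add //.
    apply/subset_leq_card/subsetP => x; rewrite !in_setU => /orP[->|->]; rewrite ?orbT //.
  rewrite -(cards1 (v b)); apply/subset_leq_card/subsetP => x /setIP[xA xB].
  by rewrite inE (dAB x).
have h2 : 2 <= #|S2|.
  have <- : #|[set v s2; v r]| = 2 by rewrite cards2 nrs.
  apply/subset_leq_card/subsetP => x /set2P[]->; [exact: path_on_endr p2|exact: path_on_endl p2].
exists (#|SA :|: S1 :|: SB| + #|S2| - 2); first arith.
apply: (path_on_cycle p3 p2 nrs); last arith.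
move=> x xS /(subsetP sS2) x2; case/setUP: xS => [/setUP[]|].
- move=> /(subsetP sSA)/segP[k hk E]; left; subst x; congr v.
  by apply: A2 x2; arith.
- by move=> /(subsetP sS1) x1; rewrite (disjointFr d x1) in x2.
- move=> /(subsetP sSB)/segP[k hk E]; right; subst x; congr v.
  by apply: B2 x2; arith.
Qed.

(** Either some neighbour of [v 0] comes after some neighbour of [v m.-1] on the path, or none
    does. *)
Lemma path_degree_cycle v m B c : indexed_path G v m -> (forall k, k < m -> v k \in B) ->
  (forall z, connected_in G (B :\ z)) -> 2 <= c -> c < m ->
  c < deg_in G (v 0) (seg v 0 m.-1) + deg_in G (v m.-1) (seg v 0 m.-1) ->
  exists2 k, c < k & has_cycle G k.
Proof.
move=> vp vB cB c2 cm hd.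
case: (boolP [exists i : 'I_m, exists j : 'I_m,
    [&& i < j, G (v 0) (v j) & G (v m.-1) (v i)]]) => [|no].
  case/existsP=> i /existsP[j /and3P[ij Gj Gi]].
  by apply: crossing_cycle hd _ => //; exists i, j; rewrite ij ltn_ord.
apply: (noncrossing_cycle vp vB) hd _ => // i j /andP[ij jm] Gj Gi; case/negP: no.
apply/existsP; exists (Ordinal (ltn_trans ij jm)); apply/existsP; exists (Ordinal jm) => /=.
by rewrite ij Gj Gi.
Qed.

End Kopylov.

(** * Cliques in a large block *)

Section BlockBound.
Variables (T : finType) (G : sgraph T).
Implicit Types (u w x y z : T) (A B C H S X Y : {set T}).

Lemma cliqueP A : reflect {in A &, forall x y, x != y -> G x y} (clique G A).
Proof.
apply: (iffP forall_inP) => [h x y xA yA ne|h x xA].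
  by have /forall_inP/(_ _ yA)/implyP := h _ xA; apply.
by apply/forall_inP => y yA; apply/implyP; exact: h.
Qed.

Lemma clique_sub A B : A \subset B -> clique G B -> clique G A.
Proof.
move=> /subsetP s /cliqueP cB; apply/cliqueP => x y /s xB /s; exact: cB.
Qed.

Lemma clique_path_on A x y : clique G A -> x \in A -> y \in A -> x != y -> path_on G x y A.
Proof.
move=> /cliqueP cA xA yA ne.
have pathG q u : uniq (u :: q) -> {subset u :: q <= A} -> path G u q.
  elim: q u => //= a q IH u /andP[uq uq'] s.
  rewrite cA ?s ?inE ?eqxx ?orbT //=; last by apply: contraNneq uq => ->; rewrite inE eqxx.
  by apply: IH => // t tq; apply: s; rewrite inE tq orbT.
have E t : t \in x :: rcons (enum (A :\ x :\ y)) y = (t \in A).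
  rewrite inE mem_rcons inE mem_enum !inE.
  by case: eqP => [->//|_]; case: eqP => [->//|_].
have U : uniq (x :: rcons (enum (A :\ x :\ y)) y).
  by rewrite /= rcons_uniq enum_uniq mem_rcons inE !mem_enum !inE !eqxx (negPf ne) //= ?andbF.
exists (rcons (enum (A :\ x :\ y)) y); split => //.
- by apply: pathG => // t; rewrite E.
- by rewrite last_rcons.
Qed.

Lemma clique_cycle A : clique G A -> 2 < #|A| -> has_cycle G #|A|.
Proof.
move=> cA h; have /card_gt1P[x [y [xA yA ne]]] : 1 < #|A| by arith.
apply: (path_on_cycle_edge (clique_path_on cA xA yA ne)) => //.
by move/cliqueP: cA; apply.
Qed.

(** * Counting cliques by deleting vertices of small degree *)

Definition num_cliques_in s A := #|[set C : {set T} | is_K G s C & C \subset A]|.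

Lemma num_cliques_in_le_bin s A : num_cliques_in s A <= 'C(#|A|, s).
Proof.
rewrite -cards_draws; apply/subset_leq_card/subsetP => C; rewrite !inE.
by case/andP=> /andP[-> _] ->.
Qed.

Lemma num_cliques_in_clique s A : clique G A -> num_cliques_in s A = 'C(#|A|, s).
Proof.
move=> cA; rewrite -cards_draws; apply: eq_card => C; rewrite !inE andbC /is_K.
by case: (boolP (C \subset A)) => //= /clique_sub/(_ cA) ->; rewrite andbT.
Qed.

(** Removing [v] sends the cliques through [v] injectively to subsets of size [s.-1] of its
    neighbourhood in [A]. *)
Lemma num_cliques_in_remove s A v : v \in A -> 0 < s ->
  num_cliques_in s A <= num_cliques_in s (A :\ v) + 'C(deg_in G v A, s.-1).
Proof.
move=> vA s0; rewrite /num_cliques_in -(cardsID [set C : {set T} | v \in C] [set C : {set T} | _ & _]) addnC.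
apply: leq_add.
  apply/subset_leq_card/subsetP => C; rewrite !inE => /andP[vC /andP[-> CA]] /=.
  by rewrite subsetD1 CA.
rewrite -cards_draws -(card_in_imset (f := fun C : {set T} => C :\ v)); last first.
  move=> C D; rewrite !inE => /andP[_ vC] /andP[_ vD] E.
  by rewrite -(setD1K vC) E setD1K.
apply/subset_leq_card/subsetP => D /imsetP[C]; rewrite !inE => /andP[/andP[/andP[/eqP cs cC] CA] vC] ->.
rewrite [X in X == _](_ : _ = s.-1) ?eqxx ?andbT; last first.
  by rewrite -cs [in RHS](cardsD1 v) vC.
apply/subsetP => x /setD1P[xv xC]; rewrite inE (subsetP CA) //=.
by move/cliqueP: cC; apply; rewrite // eq_sym.
Qed.

(** With the strict inequality, the largest such set is the (t+1)-core. *)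
Definition min_deg_gt t H : Prop := forall v, v \in H -> t < deg_in G v H.

(** Vertices of degree at most [t] are deleted one by one, each costing at most ['C(t, s.-1)]
    cliques. A subset of minimum degree above [t] never loses a vertex, so what remains is the
    largest one. *)
Lemma core_exists s t B : 0 < s -> exists H, [/\ H \subset B, min_deg_gt t H,
  (forall H', H' \subset B -> min_deg_gt t H' -> H' \subset H)
  & num_cliques_in s B <= num_cliques_in s H + (#|B| - #|H|) * 'C(t, s.-1)].
Proof.
move=> s0; move: {2}#|B| (leqnn #|B|) => n; elim: n B => [|n IH] B hn.
  exists B; split => //; last by rewrite subnn addn0.
  by move=> v; rewrite (cards0_eq (A := B)) ?inE //; arith.
case: (boolP [forall v in B, t < deg_in G v B]) => [/forall_inP h|].
  by exists B; split => //; rewrite subnn addn0.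
rewrite negb_forall => /existsP[v]; rewrite negb_imply -leqNgt => /andP[vB dv].
have cB : #|B| = #|B :\ v|.+1 by rewrite (cardsD1 v) vB.
case: (IH (B :\ v)); first arith.
move=> H [sH mH xH cH]; exists H; split => //.
- exact: subset_trans sH (subsetDl _ _).
- move=> H' sH' mH'; apply: xH => //; rewrite subsetD1 sH'; apply/negP => vH'.
  have := mH' _ vH'; have := deg_in_sub G v sH'; arith.
- apply: leq_trans (num_cliques_in_remove vB s0) _.
  have le := subset_leq_card sH.
  have -> : #|B| - #|H| = (#|B :\ v| - #|H|).+1 by arith.
  rewrite mulSn [X in _ <= _ + X]addnC addnA leq_add //; exact: leq_bin2l.
Qed.

(** When the core is empty, the deletion can be stopped at [t.+1] vertices, on which all subsets are
    counted. *)
Lemma num_cliques_in_degenerate s t B : 0 < s ->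
  (forall H, H \subset B -> min_deg_gt t H -> H = set0) ->
  num_cliques_in s B <= 'C(t.+1, s) + (#|B| - t.+1) * 'C(t, s.-1).
Proof.
move=> s0; move: {2}#|B| (leqnn #|B|) => n; elim: n B => [|n IH] B hn hB.
  by apply: leq_trans (num_cliques_in_le_bin _ _) _; rewrite (leq_trans _ (leq_addr _ _)) // leq_bin2l; arith.
have [le|gt] := leqP #|B| t.+1.
  by apply: leq_trans (num_cliques_in_le_bin _ _) _; rewrite (leq_trans _ (leq_addr _ _)) // leq_bin2l.
case: (boolP [forall v in B, t < deg_in G v B]) => [/forall_inP h|].
  by move: gt; rewrite (hB B) // cards0.
rewrite negb_forall => /existsP[v]; rewrite negb_imply -leqNgt => /andP[vB dv].
have cB : #|B| = #|B :\ v|.+1 by rewrite (cardsD1 v) vB.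
apply: leq_trans (num_cliques_in_remove vB s0) _.
have -> : #|B| - t.+1 = (#|B :\ v| - t.+1).+1 by arith.
rewrite mulSn [X in _ <= _ + X]addnC addnA leq_add ?leq_bin2l //.
apply: IH; first arith.
by move=> H sH; apply: hB; apply: subset_trans sH (subsetDl _ _).
Qed.

Lemma path_on_indexed_path x y S : path_on G x y S -> exists v,
  [/\ indexed_path G v #|S|, v 0 = x, v #|S|.-1 = y & S = seg v 0 #|S|.-1].
Proof.
case=> q [pq lq uq eS]; have E : #|S| = (size q).+1 by rewrite (eq_card eS) (card_uniqP uq).
exists (nth x (x :: q)); rewrite E; split => //.
- split=> [i j im jm /eqP|i im]; first by rewrite nth_uniq // => /eqP.
  by have /(pathP x)/(_ i) := pq; apply.
- by rewrite nth_last.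
- apply/setP => t; rewrite eS; apply/idP/segP => [/(nthP x)[k kq <-]|[k kq ->]].
    by exists k => //; move: kq => /=; arith.
  by apply: mem_nth => /=; arith.
Qed.

Section Block.
Variables (B : {set T}) (c : nat).
Hypotheses (cB : forall z, connected_in G (B :\ z)) (c2 : 2 <= c).
Hypothesis circ : circumference G <= c.
Hypothesis long_path : forall x y, x \in B -> y \in B -> x != y -> ~~ G x y ->
  exists S, [/\ S \subset B, path_on G x y S & c < #|S|].

Lemma no_cycle k : c < k -> has_cycle G k -> False.
Proof. by move=> ck /has_cycle_circ; arith. Qed.

(* A longest path joining non-adjacent x in X and y in Y contains all X-neighbours
   of x and all Y-neighbours of y. *)
Lemma all_adjacent X Y dx dy : X \subset B -> Y \subset B ->
  (forall x, x \in X -> dx <= deg_in G x X) -> (forall y, y \in Y -> dy <= deg_in G y Y) ->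
  c < dx + dy -> forall x y, x \in X -> y \in Y -> x != y -> G x y.
Proof.
move=> sX sY hX hY hd x y xX yY ne; apply/idPn => nG.
have [S [sS pS cS]] := long_path (subsetP sX _ xX) (subsetP sY _ yY) ne nG.
(* Induction on the number of vertices off the path: a neighbour outside [S] prolongs it. *)
move: {2}(#|T| - #|S|) (leqnn (#|T| - #|S|)) => n.
elim: n x y S xX yY ne nG sS pS cS => [|n IH] x y S xX yY ne nG sS pS cS hn.
  (* A path containing these neighbours of both ends would yield, by the degree sum, a cycle longer
     than [c]. *)
  all: have allS : (forall w, w \in X -> G x w -> w \in S) ->
     (forall w, w \in Y -> G y w -> w \in S) -> False.
  1,3: move=> hx hy; have [v [vp v0 v1 Es]] := path_on_indexed_path pS.
  1,2: have [k ck] : exists2 k, c < k & has_cycle G k; last exact: no_cycle.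
  1,2: apply: (path_degree_cycle (B := B) vp) => //.
  1,3: by move=> k hk; apply: (subsetP sS); rewrite Es mem_seg //; arith.
  1,2: rewrite v0 v1 -Es; apply: leq_trans hd (leq_add _ _).
  1,3: apply: leq_trans (hX _ xX) _; apply/subset_leq_card/subsetP => w;
       by rewrite !inE => /andP[wX Gw]; rewrite Gw hx.
  1,2: apply: leq_trans (hY _ yY) _; apply/subset_leq_card/subsetP => w;
       by rewrite !inE => /andP[wX Gw]; rewrite Gw hy.
  have fT : S = setT.
    by apply/eqP; rewrite eqEcard subsetT cardsT; have := max_card (mem S); arith.
  by apply: allS => w; rewrite fT inE.
apply: allS => w wZ Gw; apply/idPn => wS.
  have ww : w != y by apply: contraNneq wS => ->; exact: path_on_endr pS.
  have p' : path_on G w y (w |: S).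
    have -> : w |: S = [set w; x] :|: S.
      apply/setP => t; rewrite !inE; case: (t =P x) => [->|]; rewrite ?orbF //.
      by rewrite (path_on_endl pS) !orbT.
    apply: path_on_cat pS _; first by apply: path_on_edge; rewrite adj_sym.
    by move=> t /set2P[]-> // h; rewrite h in wS.
  have cw : #|w |: S| = #|S|.+1 by rewrite cardsU1 wS.
  (* If the new end [w] were adjacent to [y], the longer path would close to a cycle that is too
     long. So the pair is again non-adjacent and the induction goes on. *)
  have [Gwy|nGwy] := boolP (G w y).
    by apply: (@no_cycle #|w |: S|); [arith | apply: path_on_cycle_edge p' Gwy _; arith].
  apply: (IH w y (w |: S)) => //; try arith.
  by rewrite subUset sub1set sS (subsetP sX).
have ww : x != w by apply: contraNneq wS => <-; exact: path_on_endl pS.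
have p' : path_on G x w (w |: S).
  have -> : w |: S = S :|: [set y; w].
    apply/setP => t; rewrite !inE; case: (t =P y) => [->|]; rewrite ?orbF //.
      by rewrite (path_on_endr pS) !orbT.
    by rewrite orbC.
  apply: (path_on_cat pS); first exact: path_on_edge.
  by move=> t tS /set2P[] // h; rewrite -h tS in wS.
have cw : #|w |: S| = #|S|.+1 by rewrite cardsU1 wS.
have [Gwy|nGwy] := boolP (G x w).
  by apply: (@no_cycle #|w |: S|); [arith | apply: path_on_cycle_edge p' Gwy _; arith].
apply: (IH x w (w |: S)) => //; try arith.
by rewrite subUset sub1set sS (subsetP sY).
Qed.

(** Deleting any [u] other than [v] leaves [v] connected to a third vertex, so [v] has a neighbour
    other than [u]. This is applied twice. *)
Lemma min_deg2 : 2 < #|B| -> min_deg_gt 1 B.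
Proof.
move=> h3 v vB.
have nbr u : u != v -> exists w, [/\ w \in B, w != u & G v w].
  move=> nu.
  have /card_gt0P[z] : 0 < #|B :\ v :\ u|.
    have := cardsD1 v B; have := cardsD1 u (B :\ v); rewrite vB /=; arith.
  rewrite !inE => /and3P[zu zv zB].
  have : connect (in_rel G (B :\ u)) v z.
    by have /connected_inP := cB u; apply; rewrite !inE ?zu ?zB // eq_sym nu.
  case/connectP => -[|w q] /=; first by move=> _ E; rewrite E eqxx in zv.
  by case/andP=> /and3P[_]; rewrite !inE => /andP[wu wB] Gw _ _; exists w.
have [z zv] : exists z, z != v.
  have /card_gt0P[z] : 0 < #|B :\ v| by have := cardsD1 v B; rewrite vB /=; arith.
  by rewrite !inE => /andP[]; exists z.
have [w [wB _ Gw]] := nbr z zv.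
have wv : w != v by apply: contraTneq Gw => ->; rewrite adj_irr.
have [w' [wB' ww Gw']] := nbr w wv.
have <- : #|[set w; w']| = 2 by rewrite cards2 eq_sym ww.
by apply/subset_leq_card/subsetP => t /set2P[]->; rewrite inE ?wB ?wB'.
Qed.

(** For a non-empty core, [r] is its size and [k] is [c.+1 - r]; for an empty one they are [t.+1]
    and [t]. *)
Lemma block_bound s : 0 < s -> 3 <= c -> c < #|B| -> exists r k,
  [/\ r + k <= c.+1, k < r, r < c, 0 < k &
      num_cliques_in s B <= 'C(r, s) + (#|B| - r) * 'C(k, s.-1)].
Proof.
move=> s0 c3 cb; pose t := c./2.
(* The first inequality makes two core degrees add up to more than [c]; the second gives
   [r + k <= c.+1] for an empty core. *)
have tc : c <= t.*2.+1 <= c.+1 by rewrite /t; arith.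
have [H [sH mH xH _]] := core_exists t B s0.
have [H0|/set0Pn[v0 v0H]] := eqVneq H set0.
  exists t.+1, t; split; try arith.
  by apply: num_cliques_in_degenerate => // H' sH' /xH -/(_ sH'); rewrite H0 subset0 => /eqP.
have cH : clique G H.
  by apply/cliqueP; apply: (all_adjacent sH sH (dx := t.+1) (dy := t.+1)) => //; arith.
have rt : t.+2 <= #|H|.
  have := mH _ v0H; rewrite (cardsD1 v0 H) v0H => h.
  rewrite add1n ltnS; apply: (leq_trans h); apply/subset_leq_card/subsetP => x.
  rewrite !inE => /andP[-> Gx]; rewrite andbT; apply: contraTneq Gx => ->; by rewrite adj_irr.
have degH x : x \in H -> #|H|.-1 <= deg_in G x H.
  move=> xH'; rewrite (cardsD1 x H) xH' add1n /=; apply/subset_leq_card/subsetP => y.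
  by rewrite !inE => /andP[yx yH]; rewrite yH; move/cliqueP: cH; apply; rewrite // eq_sym.
(* A vertex adjacent to all of [H] could join it, since [H] has more than [t] vertices, against the
   maximality of the core. *)
have noext Y : Y \subset B -> (forall x y, x \in H -> y \in Y -> x != y -> G x y) -> Y \subset H.
  move=> sY hY; apply/subsetP => y yY; apply/idPn => yH.
  suff /subsetP/(_ y) : y |: H \subset H by rewrite setU11 (negPf yH) => /(_ isT).
  apply: xH; first by rewrite subUset sub1set sH (subsetP sY).
  have sub : H \subset y |: H by exact: subsetUr.
  move=> w /setU1P[->|wH]; last exact: leq_trans (mH _ wH) (deg_in_sub _ _ sub).
  apply: (@leq_trans #|H|); first arith.
  apply/subset_leq_card/subsetP => x xH'; rewrite !inE xH' orbT adj_sym hY //.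
  by apply: contraTneq xH' => ->.
(* Otherwise degree at least [c - 1] in [H] and 2 in [B] suffice for every vertex of [B] to be
   adjacent to [H]. Then [B] is the clique [H], which has a cycle longer than [c]. *)
have rc : #|H| < c.
  rewrite ltnNge; apply/negP => hr.
  have sBH : B \subset H.
    apply: noext => // x y xH' yB; apply: (all_adjacent sH (subxx _) degH (dy := 2)) => //.
      by apply: min_deg2; arith.
    by arith.
  have EB : B = H by apply/eqP; rewrite eqEsubset sBH.
  by apply: (no_cycle cb); rewrite EB; apply: clique_cycle => //; rewrite -EB; arith.
(* Degrees [#|H|.-1] in [H] and [k.+1] in [H'] add up to more than [c], so [noext] puts [H'] inside
   [H]. *)
pose k := c.+1 - #|H|.
have [H' [sH' mH' xH' cH']] := core_exists k B s0.
have EH : H' = H.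
  apply/eqP; rewrite eqEsubset; apply/andP; split.
    apply: noext => // x y xH0 yH; apply: (all_adjacent sH sH' degH (dy := k.+1)) => //.
    by arith.
  by apply: xH' => // v vH; have := degH _ vH; arith.
exists #|H|, k; split; try arith.
apply: (leq_trans cH'); rewrite EH leq_add2r; exact: num_cliques_in_le_bin.
Qed.

End Block.
End BlockBound.

(** * Numerical estimates *)

Section Binomials.
Implicit Types a b d e k m n r s c x y p : nat.

(** The binomial ['C(x, m.+1)] is convex in [x], and ['C(k, m)] is its forward difference at [k]:
    the tangent line there stays below it. *)
Lemma bin_tangent m a k :
  'C(k, m.+1) + a * 'C(k, m) <= 'C(a, m.+1) + k * 'C(k, m).
Proof.
have [ka|ak] := leqP k a.
  rewrite -(subnKC ka); elim: (a - k) => [|d IH]; first by rewrite addn0.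
  rewrite addnS binS mulSn; have := leq_bin2l m (leq_addr d k); lia.
rewrite -(subKn (ltnW ak)); have : k - a <= k by lia.
elim: (k - a) => [|d IH] dk; first by rewrite subn0.
have := IH (ltnW dk); rewrite (_ : k - d = (k - d.+1).+1); last lia.
rewrite binS mulSn; have := leq_bin2l m (leq_subr d.+1 k); lia.
Qed.

Lemma ltn_bin m a b : a < b -> m < b -> 'C(a, m.+1) < 'C(b, m.+1).
Proof.
case: b => // b ab mb; rewrite binS -addn1 leq_add ?leq_bin2l ?bin_gt0 //.
Qed.

(** A second-order lower bound: the increment ['C(r + i, m.+1)] is at least
    ['C(k, m.+1) + i.+1 * 'C(k, m)], summed over [i < e]. *)
Lemma bin_growth m r k e : k < r ->
  'C(r, m.+2) + e * 'C(k, m.+1) + 'C(e.+1, 2) * 'C(k, m) <= 'C(r + e, m.+2).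
Proof.
move=> kr; elim: e => [|e IH]; first by rewrite (@bin_small 1 2) // !mul0n !addn0.
rewrite addnS (binS (r + e)) (binS e.+1 1) bin1.
have lin d : 'C(k, m.+1) + d * 'C(k, m) <= 'C(k + d, m.+1).
  by have := bin_tangent m (k + d) k; rewrite mulnDl; lia.
have h : 'C(k, m.+1) + e.+1 * 'C(k, m) <= 'C(r + e, m.+1).
  by apply: leq_trans (lin _) _; rewrite leq_bin2l; lia.
rewrite mulnDl (mulSn e); lia.
Qed.

(** With [r + e = c] and [m.+3 = s], this compares a core on [r] vertices, together with outside
    vertices, to a complete graph on [c] vertices. The quadratic term of [bin_growth] makes the
    inequality strict. *)
Lemma bin_gap m r k e : 0 < e -> k <= e.+1 -> k < r -> m.+2 < r + e ->
  'C(r, m.+3) + (e + k - 1) * 'C(k, m.+2) < 'C(r + e, m.+3).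
Proof.
move=> e0 ke kr mr.
have [km|mk] := ltnP k m.+2.
  by rewrite (bin_small km) muln0 addn0 ltn_bin; lia.
have h := bin_growth m.+1 e kr.
have q0 : 0 < 'C(k, m.+2) by rewrite bin_gt0.
(* The factor 2 is at most [m.+2], that is, [s - 1]; absorption and [k <= e.+1] give the rest. *)
have h1 : 2 * 'C(k, m.+2) <= e * 'C(k, m.+1).
  apply: (@leq_trans (m.+2 * 'C(k, m.+2))); first by rewrite leq_mul2r orbT.
  by rewrite mul_bin_left leq_mul2r; apply/orP; right; lia.
have h2 : e.+1 * 'C(k, m.+2) <= 'C(e.+1, 2) * 'C(k, m.+1).
  rewrite -(leq_pmul2l (isT : 0 < 2)) mulnA (mulnA 2).
  have -> : 2 * 'C(e.+1, 2) = e.+1 * e by rewrite mul_bin_left bin1 subn1 mulnC.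
  by rewrite (mulnC 2) -!mulnA leq_mul2l h1 orbT.
have h3 : (e + k - 1) * 'C(k, m.+2) + 'C(k, m.+2) <= e * 'C(k, m.+2) + e.+1 * 'C(k, m.+2).
  by rewrite -mulSnr -mulnDl leq_mul2r; apply/orP; right; lia.
lia.
Qed.

Lemma bin_convex m a b d : a <= b ->
  'C(a + d, m.+1) + 'C(b, m.+1) <= 'C(a, m.+1) + 'C(b + d, m.+1).
Proof.
move=> ab; elim: d => [|d IH]; first by rewrite !addn0.
rewrite !addnS !binS; have : 'C(a + d, m) <= 'C(b + d, m) by rewrite leq_bin2l; lia.
lia.
Qed.

Lemma bin_convex_lt m a b d : a < b -> 0 < d -> m.+1 < b + d ->
  'C(a + d, m.+2) + 'C(b, m.+2) < 'C(a, m.+2) + 'C(b + d, m.+2).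
Proof.
case: d => // d ab _ mbd; rewrite !addnS !binS.
have := bin_convex m.+1 d (ltnW ab).
have : 'C(a + d, m.+1) < 'C(b + d, m.+1) by apply: ltn_bin; lia.
lia.
Qed.

End Binomials.

(** * Superadditivity of the extremal function *)

Section Extremal.
Variables (s c : nat).
Hypotheses (hs : 3 <= s) (hsc : s <= c).

(* [max_cliques x] is h_s(x + 1, c). *)
Definition max_cliques (x : nat) := x %/ (c - 1) * 'C(c, s) + 'C(x %% (c - 1) + 1, s).

Lemma max_cliquesE q p : p < c - 1 ->
  max_cliques (q * (c - 1) + p) = q * 'C(c, s) + 'C(p + 1, s).
Proof.
move=> h; rewrite /max_cliques divnMDl ?modnMDl ?divn_small ?modn_small ?addn0 //; lia.
Qed.

Lemma max_cliques_small p : p < c - 1 -> max_cliques p = 'C(p + 1, s).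
Proof. exact: (@max_cliquesE 0). Qed.

Lemma max_cliques_full : max_cliques (c - 1) = 'C(c, s).
Proof.
have := @max_cliquesE 1 0; rewrite mul1n addn0 => ->; last lia.
by rewrite mul1n (bin_small (n := 0 + 1)) ?addn0 //; lia.
Qed.

Lemma max_cliques_addM q x : max_cliques (q * (c - 1) + x) = q * 'C(c, s) + max_cliques x.
Proof. by rewrite /max_cliques divnMDl ?modnMDl ?mulnDl ?addnA //; lia. Qed.

(** The sizes [p + 1], [p' + 1] and [p + p' - (c - 1) + 1], [c] have the same sum, and the second
    pair is further apart. Convexity is strict because [s <= c]. *)
Lemma max_cliques_carry p p' : p < c - 1 -> p' < c - 1 -> c - 1 <= p + p' ->
  max_cliques p + max_cliques p' < max_cliques (p + p').
Proof.
move=> hp hp' hpp; have -> : p + p' = 1 * (c - 1) + (p + p' - (c - 1)) by lia.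
rewrite max_cliquesE ?max_cliques_small //; last lia.
have := @bin_convex_lt s.-2 (p + p' - (c - 1) + 1) (p' + 1) (c - 1 - p').
have -> : s.-2.+2 = s by lia.
have -> : p + p' - (c - 1) + 1 + (c - 1 - p') = p + 1 by lia.
have -> : p' + 1 + (c - 1 - p') = c by lia.
lia.
Qed.

Lemma max_cliques_super x y : max_cliques x + max_cliques y <= max_cliques (x + y).
Proof.
have hd : 0 < c - 1 by lia.
have [q [p [hp ->]]] : exists q p, p < c - 1 /\ x = q * (c - 1) + p.
  by exists (x %/ (c - 1)), (x %% (c - 1)); rewrite ltn_mod hd -divn_eq.
have [q' [p' [hp' ->]]] : exists q p, p < c - 1 /\ y = q * (c - 1) + p.
  by exists (y %/ (c - 1)), (y %% (c - 1)); rewrite ltn_mod hd -divn_eq.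
rewrite addnACA -mulnDl !max_cliques_addM mulnDl.
suff : max_cliques p + max_cliques p' <= max_cliques (p + p') by lia.
have [h|h] := leqP (c - 1) (p + p'); first exact/ltnW/max_cliques_carry.
rewrite !max_cliques_small //.
have := @bin_convex s.-1 1 (p' + 1) p.
have -> : s.-1.+1 = s by lia.
rewrite (bin_small (n := 1)) ?add0n; last by lia.
by rewrite (addnC 1 p) (_ : p' + 1 + p = p + p' + 1); lia.
Qed.

(** Strict convexity, spreading the sizes [p + 1], [p' + 1] to 1 and [p + p' + 1]. *)
Lemma max_cliques_small_lt p p' : 0 < p -> 0 < p' -> p + p' < c - 1 ->
  s <= p + p' + 1 -> max_cliques p + max_cliques p' < max_cliques (p + p').
Proof.
move=> hp hp' h hspp; rewrite !max_cliques_small //; try lia.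
have := @bin_convex_lt s.-2 1 (p' + 1) p.
have -> : s.-2.+2 = s by lia.
rewrite (bin_small (n := 1)) ?add0n; last by lia.
by rewrite (addnC 1 p) (_ : p' + 1 + p = p + p' + 1); lia.
Qed.

(** Write [b - 1] as [q * (c - 1) + p]. The core and some outside vertices are beaten strictly by
    one ['C(c, s)] through [bin_gap]; each further group of [c - 1] vertices is bounded by another,
    and the remainder by ['C(p + 1, s)] through the tangent at [k]. *)
Lemma big_block_lt b r k : c < b -> r + k <= c.+1 -> k < r -> r < c -> 0 < k ->
  'C(r, s) + (b - r) * 'C(k, s.-1) < max_cliques (b - 1).
Proof.
move=> cb rk kr rc k0; have hd : 0 < c - 1 by lia.
have [q [p [hp Eb]]] : exists q p, p < c - 1 /\ b - 1 = q * (c - 1) + p.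
  by exists ((b - 1) %/ (c - 1)), ((b - 1) %% (c - 1)); rewrite ltn_mod hd -divn_eq.
rewrite Eb max_cliquesE //.
have q0 : 0 < q by case: q Eb => //; lia.
have [q' Eq] : exists q', q = q'.+1 by exists q.-1; lia.
have Eb' : b - r = q' * (c - 1) + (c - r + p) by rewrite Eq mulSn in Eb; lia.
have gap := @bin_gap (s - 3) r k (c - r).
have tan1 := bin_tangent s.-1 (p + 1) k.
have tan2 := bin_tangent s.-1 r k.
have e1 : (s - 3).+3 = s by lia.
have e2 : (s - 3).+2 = s.-1 by lia.
have e3 : s.-1.+1 = s by lia.
have e4 : r + (c - r) = c by lia.
rewrite ?e1 ?e2 ?e3 ?e4 in gap tan1 tan2.
have {}gap : 'C(r, s) + (c - r + k - 1) * 'C(k, s.-1) < 'C(c, s) by apply: gap; lia.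
rewrite Eb' Eq mulSn; move: ('C(k, s.-1)) gap tan1 tan2 => Q gap tan1 tan2.
(* The tangent at [k], evaluated at [r], combined with [gap]. *)
have slope : (c - 1) * Q <= 'C(c, s).
  have E : (c - 1) * Q + k * Q = (c - r + k - 1) * Q + r * Q by rewrite -!mulnDl; congr (_ * _); lia.
  lia.
have slopes : q' * (c - 1) * Q <= q' * 'C(c, s) by rewrite -mulnA leq_mul2l slope orbT.
have E : (c - r + p) * Q + k * Q = (c - r + k - 1) * Q + (p + 1) * Q.
  by rewrite -!mulnDl; congr (_ * _); lia.
rewrite mulnDl; lia.
Qed.

Section Sum.
Variables (I : finType) (F : {set I}) (f : I -> nat).

Lemma max_cliques_sum : \sum_(i in F) max_cliques (f i) <= max_cliques (\sum_(i in F) f i).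
Proof.
apply: (big_ind2 (fun a b => a <= max_cliques b)) => // a a' b b' h h'.
exact: leq_trans (leq_add h h') (max_cliques_super _ _).
Qed.

Lemma max_cliques_sum_lt i0 g : i0 \in F -> (forall i, i \in F -> g i <= max_cliques (f i)) ->
  g i0 < max_cliques (f i0) -> \sum_(i in F) g i < max_cliques (\sum_(i in F) f i).
Proof.
move=> iF hg hi; apply: leq_trans max_cliques_sum.
rewrite (bigD1 i0 iF) [X in _ <= X](bigD1 i0 iF) /= -addSn leq_add //.
by apply: leq_sum => i /andP[/hg].
Qed.

(** Equality leaves no slack in any addition, whereas a carry loses strictly. Hence every partial
    sum stays below [c - 1]. *)
Lemma no_carry : (forall i, i \in F -> f i < c - 1) ->
  \sum_(i in F) max_cliques (f i) = max_cliques (\sum_(i in F) f i) ->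
  \sum_(i in F) f i < c - 1.
Proof.
move=> hf; suff [_ h] : (fun a b => a <= max_cliques b /\ (a = max_cliques b -> b < c - 1))
  (\sum_(i in F) max_cliques (f i)) (\sum_(i in F) f i) by exact: h.
apply: (big_ind2 (fun a b => a <= max_cliques b /\ (a = max_cliques b -> b < c - 1))).
- by split=> // _; lia.
- move=> a b a' b' [l h] [l' h']; have sup := max_cliques_super b b'; split; first lia.
  move=> E; have hb : b < c - 1 by apply: h; lia.
  have hb' : b' < c - 1 by apply: h'; lia.
  by rewrite ltnNge; apply/negP => car; have := max_cliques_carry hb hb' car; lia.
- by move=> i /hf; split.
Qed.

End Sum.

(** Here [f] stands for the block sizes minus one. The full values split off without loss, and the
    others sum to the remainder by [no_carry]. If [s] is at most the remainder plus one, splitting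
    the remainder in two would lose strictly. *)
Lemma extremal_sizes (I : finType) (F : {set I}) (f : I -> nat) x :
  (forall i, i \in F -> 0 < f i <= c - 1) -> \sum_(i in F) f i = x ->
  \sum_(i in F) max_cliques (f i) = max_cliques x ->
  #|[set i in F | f i == c - 1]| = x %/ (c - 1) /\
  (s <= x %% (c - 1) + 1 ->
    exists i0, [set i in F | f i != c - 1] = [set i0] /\ f i0 = x %% (c - 1)).
Proof.
move=> hf Ex Eg; have hd : 0 < c - 1 by lia.
set A := [set i in F | f i == c - 1]; set R := [set i in F | f i != c - 1].
have split_sum g : \sum_(i in F) g i = \sum_(i in A) g i + \sum_(i in R) g i.
  rewrite (bigID (fun i => f i == c - 1)) /=.
  by congr (_ + _); apply: eq_bigl => i; rewrite inE.
have sA (g : nat -> nat) : \sum_(i in A) g (f i) = #|A| * g (c - 1).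
  rewrite -sum_nat_const; apply: eq_bigr => i; by rewrite inE => /andP[_ /eqP->].
have hR i : i \in R -> 0 < f i < c - 1.
  by rewrite inE => /andP[/hf h1 h2]; lia.
pose y := \sum_(i in R) f i.
have Exy : x = #|A| * (c - 1) + y by rewrite -Ex split_sum (sA id).
have Ey : \sum_(i in R) max_cliques (f i) = max_cliques y.
  move: Eg; rewrite split_sum (sA max_cliques) max_cliques_full Exy max_cliques_addM; lia.
have yc : y < c - 1 by apply: no_carry Ey => i /hR; lia.
have Ediv : x %/ (c - 1) = #|A| by rewrite Exy divnMDl // divn_small // addn0.
have Emod : x %% (c - 1) = y by rewrite Exy modnMDl modn_small.
rewrite Ediv Emod; split=> // sy.
have [R0|/set0Pn[i0 iR]] := eqVneq R set0.
  by move: sy; rewrite /y R0 big_set0; lia.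
exists i0.
pose z := \sum_(i in R :\ i0) f i.
have Ez : y = f i0 + z by rewrite /y (big_setD1 i0).
have [z0|zp] := posnP z.
  split; last by rewrite Ez z0 addn0.
  apply/eqP; rewrite eqEsubset sub1set iR andbT; apply/subsetP => i iR'; rewrite inE.
  apply/idPn => ne; move: z0; rewrite /z (big_setD1 i) ?inE ?ne //=.
    by have := hR _ iR'; lia.
  by move: iR'; rewrite inE.
have := max_cliques_sum (R :\ i0) f; rewrite -/z => hz.
have := hR _ iR => hi.
have := @max_cliques_small_lt (f i0) z; rewrite -Ez -Ey (big_setD1 i0) //=; lia.
Qed.

End Extremal.

(** * Blocks *)

Section Blocks.
Variables (T : finType) (G : sgraph T).
Implicit Types (u v w x y z t : T) (A B C D S : {set T}).

Lemma nonseparableP A : reflect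
  [/\ A != set0, connected_in G A & forall z, connected_in G (A :\ z)]
  (nonseparable G A).
Proof.
apply: (iffP and3P) => -[A0 cA hA]; split=> //.
  move=> z; have := forallP hA z; rewrite /cut_vertex negb_and negbK.
  case: (boolP (z \in A)) => //= zA _.
  suff -> : A :\ z = A by [].
  by apply/setDidPl; rewrite disjoint_sym disjoints1.
by apply/forallP => z; rewrite /cut_vertex hA andbF.
Qed.

Lemma clique_connected A : clique G A -> connected_in G A.
Proof.
move=> /cliqueP cA; apply/connected_inP => x y xA yA.
have [->//|ne] := eqVneq x y; apply: connect1.
by rewrite /in_rel /= xA yA cA.
Qed.

Lemma clique_nonseparable A : clique G A -> A != set0 -> nonseparable G A.
Proof.
move=> cA A0; apply/nonseparableP; split=> // [|z]; first exact: clique_connected.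
by apply: clique_connected; apply: clique_sub cA; apply: subsetDl.
Qed.

Lemma edge_nonseparable x y : G x y -> nonseparable G [set x; y].
Proof.
move=> xy; apply: clique_nonseparable; last by apply/set0Pn; exists x; rewrite !inE eqxx.
by apply/cliqueP => a b /set2P[]-> /set2P[]->; rewrite ?eqxx // adj_sym.
Qed.

(** Whichever vertex is deleted, [x] or [y] survives and holds the two sets together. *)
Lemma nonseparableU A B x y : nonseparable G A -> nonseparable G B -> x != y ->
  x \in A :&: B -> y \in A :&: B -> nonseparable G (A :|: B).
Proof.
move=> /nonseparableP[A0 cA dA] /nonseparableP[B0 cB dB] ne /setIP[xA xB] /setIP[yA yB].
apply/nonseparableP; split.
- by apply/set0Pn; exists x; rewrite inE xA.
- by apply: (connected_inU cA cB xA xB); rewrite eqxx.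
move=> z; rewrite setDUl; have [xz|xz] := eqVneq x z.
  apply: (@connected_inU _ _ _ _ y y) => //; rewrite ?eqxx // !inE ?yA ?yB andbT;
    by rewrite -xz eq_sym.
by apply: (@connected_inU _ _ _ _ x x) => //; rewrite ?eqxx // !inE xz ?xA ?xB.
Qed.

(** The blocks of the subgraph induced on [A], needed for the induction that splits at a cut
    vertex. *)
Definition blocks_in A : {set {set T}} :=
  [set B | maxset (fun B => nonseparable G B && (B \subset A)) B].

Lemma blocks_inT : blocks_in setT = blocks G.
Proof.
by apply/setP => B; rewrite !inE; apply: maxset_eq => C; rewrite subsetT andbT.
Qed.

Lemma blocks_inP A B : reflect
  [/\ nonseparable G B, B \subset A &
    forall B', nonseparable G B' -> B' \subset A -> B \subset B' -> B' = B]
  (B \in blocks_in A).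
Proof.
rewrite inE; apply: (iffP maxsetP) => [[/andP[nB sB] h]|[nB sB h]]; split=> //.
- by move=> B' nB' sB'; apply: h; rewrite nB'.
- by rewrite nB.
- by move=> B' /andP[nB' sB']; apply: h.
Qed.

Lemma blocksP B : reflect
  (nonseparable G B /\ forall B', nonseparable G B' -> B \subset B' -> B' = B)
  (B \in blocks G).
Proof.
rewrite -blocks_inT; apply: (iffP (blocks_inP _ _)) => [[nB _ h]|[nB h]]; split=> //.
by move=> B' nB'; apply: h; rewrite ?subsetT.
by move=> B' nB' _; apply: h.
Qed.

Lemma nonseparable_in_block A : nonseparable G A -> exists2 B, B \in blocks G & A \subset B.
Proof.
by move=> nA; have [B mB sB] := maxset_exists nA; exists B; rewrite ?inE.
Qed.

Lemma block_unique B B' x y : B \in blocks G -> B' \in blocks G -> x != y ->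
  x \in B -> y \in B -> x \in B' -> y \in B' -> B = B'.
Proof.
move=> /blocksP[nB mB] /blocksP[nB' mB'] ne xB yB xB' yB'.
have nU : nonseparable G (B :|: B').
  by apply: (nonseparableU nB nB' ne); rewrite inE ?xB ?yB.
by rewrite -(mB _ nU (subsetUl _ _)) (mB' _ nU (subsetUr _ _)).
Qed.

Lemma num_cliques_blocks s : 1 < s ->
  num_cliques G s = \sum_(B in blocks G) num_cliques_in G s B.
Proof.
move=> s1; rewrite /num_cliques_in; under eq_bigr => B _ do rewrite -sum1_card.
rewrite (exchange_big_dep (fun C => is_K G s C)) /=; last by move=> B C _; rewrite inE => /andP[].
rewrite /num_cliques -sum1_card; apply: eq_big => [C|C]; first by rewrite inE.
rewrite inE => kC; have /andP[/eqP cC clC] := kC.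
have /card_gt1P[x [y [xC yC ne]]] : 1 < #|C| by rewrite cC.
have C0 : C != set0 by apply/set0Pn; exists x.
have [B bB sB] := nonseparable_in_block (clique_nonseparable clC C0).
rewrite (big_pred1 B) // => B'; rewrite [X in _ && X]inE kC /=; apply/andP/eqP => [[bB' sB']|-> //].
by apply: (block_unique bB' bB ne); rewrite ?(subsetP sB) ?(subsetP sB').
Qed.

Lemma path_on_split u w x S : path_on G u w S -> x \in S -> exists S1 S2,
  [/\ path_on G u x S1, path_on G x w S2, S1 \subset S, S2 \subset S &
    forall t, t \in S1 -> t \in S2 -> t = x].
Proof.
case=> q [pq lq uq eS]; rewrite eS => xq.
move: xq pq lq uq eS => /splitPl[q1 q2 lx].
rewrite cat_path last_cat lx => /andP[p1 p2] l2 uq eS.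
exists [set t in u :: q1], [set t in x :: q2].
have := uq; rewrite -cat_cons cat_uniq => /and3P[u1 dq u2].
have xq1 : x \in u :: q1 by rewrite -lx mem_last.
have xNq2 : x \notin q2 by apply: contra dq => h; apply/hasP; exists x.
split.
- by exists q1; split => // t; rewrite inE.
- by exists q2; split => //=; rewrite ?xNq2 // => t; rewrite inE.
- by apply/subsetP => t; rewrite inE eS -cat_cons mem_cat => ->.
- apply/subsetP => t; rewrite inE eS -cat_cons mem_cat inE => /predU1P[->|->].
    by rewrite xq1.
  by rewrite orbT.
move=> t; rewrite inE => t1; rewrite inE => /predU1P[//|t2].
by case/hasP: dq; exists t.
Qed.

(** Adding the path to the block keeps it nonseparable: after deleting a vertex [z], each remaining
    path vertex still reaches [B] along one of the two halves of the path. Maximality of [B] then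
    absorbs [S]. *)
Lemma path_on_in_block B u w S : B \in blocks G -> u \in B -> w \in B -> u != w ->
  path_on G u w S -> S \subset B.
Proof.
move=> /blocksP[nB mB] uB wB ne pS.
have /nonseparableP[_ cB dB] := nB.
suff nU : nonseparable G (B :|: S) by rewrite -(mB _ nU (subsetUl _ _)) subsetUr.
apply/nonseparableP; split.
- by apply/set0Pn; exists u; rewrite inE uB.
- apply: (connected_inU cB (path_on_connected pS) uB (path_on_endl pS)); by rewrite eqxx.
move=> z; pose b := if u == z then w else u.
have bB : b \in B :\ z.
  rewrite !inE /b; have [<-|uz] := eqVneq u z; first by rewrite eq_sym ne wB.
  by rewrite uz.
have fromB t : t \in B -> t != z -> connect (in_rel G ((B :|: S) :\ z)) b t.
  move=> tB tz; apply: (@connect_in_sub _ _ (B :\ z)); first exact: setSD (subsetUl _ _).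
  by have /connected_inP := dB z; apply; rewrite // !inE tz.
apply: (@connected_in_base _ _ _ b) => t /setD1P[tz /setUP[tB|tS]]; first exact: fromB.
have along S' a : a \in B -> path_on G a t S' -> S' \subset S -> z \notin S' ->
    connect (in_rel G ((B :|: S) :\ z)) b t.
  move=> aB pa sS zS'; have az : a != z.
    by apply: contraNneq zS' => <-; exact: path_on_endl pa.
  apply: connect_trans (fromB a aB az) _; apply: (@connect_in_sub _ _ S').
    by rewrite subsetD1 zS' andbT (subset_trans sS) ?subsetUr.
  by have /connected_inP := path_on_connected pa; apply; [exact: path_on_endl pa|exact: path_on_endr pa].
have [S1 [S2 [p1 p2 s1 s2 d]]] := path_on_split pS tS.
have [z1|z1] := boolP (z \in S1); last exact: along p1 s1 z1.
apply: (along S2 w wB (path_on_sym p2) s2); apply/negP => z2.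
by move: tz; rewrite (d z z1 z2) eqxx.
Qed.

Lemma block_in_card A B : connected_in G A -> 1 < #|A| -> B \in blocks_in A -> 1 < #|B|.
Proof.
move=> /connected_inP cA hA /blocks_inP[nB sB mB]; rewrite ltnNge; apply/negP => hB.
have /nonseparableP[/set0Pn[b bB] _ _] := nB.
have EB : B = [set b].
  by apply/eqP; rewrite eq_sym eqEcard sub1set bB cards1.
have bA := subsetP sB _ bB.
have /card_gt0P[t] : 0 < #|A :\ b| by have := cardsD1 b A; rewrite bA; arith.
rewrite !inE => /andP[tb tA].
case/connectP: (cA b t bA tA) => -[|a q] /=; first by move=> _ E; rewrite E eqxx in tb.
case/andP=> /and3P[_ aA ba] _ _.
have E : [set b; a] = B.
  apply: mB (edge_nonseparable ba) _ _; last by rewrite EB sub1set !inE eqxx.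
  by apply/subsetP => x /set2P[]->.
have : a \in B by rewrite -E !inE eqxx orbT.
by rewrite EB inE => /eqP E'; rewrite E' adj_irr in ba.
Qed.

(* v together with a union of components of A - v. *)
Lemma connected_lobe A D v : connected_in G A -> v \in A -> D \subset A :\ v ->
  (forall a b, a \in D -> b \in A :\ v -> G a b -> b \in D) -> connected_in G (v |: D).
Proof.
move=> /connected_inP cA vA /subsetP sD closed; apply: (@connected_in_base _ _ _ v) => x.
case/setU1P=> [->//|xD]; rewrite in_rel_connect_sym.
have xA : x \in A by have := sD _ xD; rewrite !inE => /andP[].
case/connectP: (cA x v xA vA) => q; elim: q x xD {xA} => [|a q IH] x xD /=.
  by move=> _ E; have := sD _ xD; rewrite -E !inE eqxx.
case/andP=> /and3P[_ aA Gxa] pq lq.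
have [av|av] := eqVneq a v.
  by rewrite av in Gxa; apply: connect1; rewrite /in_rel /= Gxa !inE eqxx xD orbT.
have aD : a \in D by apply: closed xD _ Gxa; rewrite !inE av.
apply: connect_trans (IH a aD pq lq); apply: connect1.
by rewrite /in_rel /= Gxa !inE aD xD !orbT.
Qed.

(** A cut vertex [v] splits [A] into two lobes that share only [v]. Their blocks together are those
    of [A], and both sides of the identity add up. *)
Lemma blocks_in_sum A : connected_in G A -> A != set0 ->
  \sum_(B in blocks_in A) (#|B| - 1) = #|A| - 1.
Proof.
move: {2}#|A| (leqnn #|A|) => n; elim: n A => [|n IH] A hn cA A0.
  by rewrite -card_gt0 in A0; arith.
have [nA|nA] := boolP (nonseparable G A).
  have -> : blocks_in A = [set A].
    apply/setP => B; rewrite in_set1; apply/blocks_inP/eqP => [[nB sB mB]|->].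
      by rewrite (mB A).
    by split=> // B' _ s1 s2; apply/eqP; rewrite eqEsubset s1.
  by rewrite big_set1.
have /existsP[v] : [exists v, cut_vertex G A v].
  by move: nA; rewrite /nonseparable A0 cA /= negb_forall => /existsP[v]; rewrite negbK => cv;
     apply/existsP; exists v.
rewrite /cut_vertex /connected_in => /andP[vA].
rewrite negb_forall => /existsP[x]; rewrite negb_imply => /andP[xA].
rewrite negb_forall => /existsP[y]; rewrite negb_imply => /andP[yA nxy].
pose C := [set t in A :\ v | connect (in_rel G (A :\ v)) x t].
have sC : C \subset A :\ v by apply/subsetP => t; rewrite inE => /andP[].
have closC a b : a \in C -> b \in A :\ v -> G a b -> b \in C.
  rewrite inE => /andP[aA xa] bA ab; rewrite inE bA (connect_trans xa) //.
  by apply: connect1; rewrite /in_rel /= aA bA.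
pose D := (A :\ v) :\: C.
have sD : D \subset A :\ v by exact: subsetDl.
have closD a b : a \in D -> b \in A :\ v -> G a b -> b \in D.
  case/setDP=> aA aC bA ab; rewrite inE bA andbT; apply: contra aC => bC.
  by apply: closC bC aA _; rewrite adj_sym.
have c1 := connected_lobe cA vA sC closC.
have c2 := connected_lobe cA vA sD closD.
have xC : x \in C by rewrite inE xA connect0.
have yD : y \in D by rewrite !inE in yA *; rewrite yA /= andbT; apply: contra nxy.
have vC : v \notin C by rewrite !inE eqxx.
have vD : v \notin D by rewrite !inE eqxx andbF.
have cards : #|A| = #|C| + #|D| + 1.
  have := cardsD (A :\ v) C; rewrite -/D (setIidPr sC) (cardsD1 v A) vA; have := subset_leq_card sC; arith.
have C0 : 0 < #|C| by apply/card_gt0P; exists x.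
have D0 : 0 < #|D| by apply/card_gt0P; exists y.
have cC : #|v |: C| = #|C|.+1 by rewrite cardsU1 vC.
have cD : #|v |: D| = #|D|.+1 by rewrite cardsU1 vD.
have s1 : v |: C \subset A.
  by rewrite subUset sub1set vA (subset_trans sC) ?subsetDl.
have s2 : v |: D \subset A.
  by rewrite subUset sub1set vA (subset_trans sD) ?subsetDl.
have dCD t : t \in v |: C -> t \in v |: D -> t = v.
  by case/setU1P=> // tC /setU1P[//|/setDP[_]]; rewrite tC.
(* A nonseparable set meeting both [C] and [D] would be disconnected by deleting [v]. *)
have side B : nonseparable G B -> B \subset A -> B \subset v |: C \/ B \subset v |: D.
  move=> /nonseparableP[_ _ dB] sB.
  have in_lobe (E : {set T}) : (forall a b, a \in E -> b \in A :\ v -> G a b -> b \in E) ->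
      forall a, a \in B :\ v -> a \in E -> B \subset v |: E.
    move=> closE a aB aE; apply/subsetP => t tB; rewrite !inE.
    have [//|tv] := eqVneq t v.
    have tB' : t \in B :\ v by rewrite !inE tv.
    have /connected_inP cB := dB v.
    case/connectP: (cB a t aB tB') => q pq ->; rewrite /=.
    elim: q a aE pq {aB} => //= b q IHq a aE /andP[/and3P[aB bB ab] pq].
    by apply: IHq => //; apply: closE aE _ ab; apply: subsetP bB; apply: setSD.
  have [|] := boolP [exists a, (a \in B :\ v) && (a \in C)].
    by case/existsP=> a /andP[aB aC]; left; exact: in_lobe closC a aB aC.
  rewrite negb_exists => /forallP no; right; apply/subsetP => t tB; rewrite in_setU1.
  have [//|tv] := eqVneq t v; have := no t.
  have tA : t \in A :\ v by rewrite in_setD1 tv (subsetP sB).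
  by rewrite in_setD1 tv tB /= => tC; rewrite /D in_setD tA tC.
have twov (E : {set T}) : E \subset v |: C -> E \subset v |: D -> #|E| <= 1.
  move=> e1 e2; rewrite -(cards1 v); apply/subset_leq_card/subsetP => t tE.
  by rewrite inE (dCD t) // ?(subsetP e1) ?(subsetP e2).
(* Blocks with at least two vertices cannot lie in both lobes; this gives maximality in [A] and
   disjointness of the two families. *)
have big1C B : B \in blocks_in (v |: C) -> 1 < #|B|.
  by apply: block_in_card => //; arith.
have big1D B : B \in blocks_in (v |: D) -> 1 < #|B|.
  by apply: block_in_card => //; arith.
have -> : blocks_in A = blocks_in (v |: C) :|: blocks_in (v |: D).
  apply/setP => B; rewrite in_setU; apply/idP/orP => [/blocks_inP[nB sB mB]|[]].
  - have [sB1|sB2] := side B nB sB; [left|right]; apply/blocks_inP; split=> // B' nB' sB';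
    by apply: mB => //; apply: subset_trans sB' _.
  - move=> BC; have /blocks_inP[nB sB mB] := BC; apply/blocks_inP; split=> //.
      exact: subset_trans sB s1.
    move=> B' nB' sB' sBB'; have [h|h] := side B' nB' sB'; first exact: mB.
    by have := twov B sB (subset_trans sBB' h); have := big1C B BC; arith.
  - move=> BC; have /blocks_inP[nB sB mB] := BC; apply/blocks_inP; split=> //.
      exact: subset_trans sB s2.
    move=> B' nB' sB' sBB'; have [h|h] := side B' nB' sB'; last exact: mB.
    by have := twov B (subset_trans sBB' h) sB; have := big1D B BC; arith.
rewrite (eq_bigl _ _ (fun B => in_setU B _ _)) bigU /=; last first.
  apply/pred0P => B /=; apply/negP => /andP[B1 B2]; have := big1C B B1.
  by case/blocks_inP: B1 => _ h1 _; case/blocks_inP: B2 => _ h2 _; have := twov B h1 h2; arith.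
rewrite !IH ?cC ?cD //; try arith.
- by apply/set0Pn; exists v; rewrite !inE eqxx.
- by apply/set0Pn; exists v; rewrite !inE eqxx.
Qed.

End Blocks.

(** * Edge-maximal graphs *)

Section AddEdge.
Variables (T : finType) (G : sgraph T).
Implicit Types (x y : T) (S : {set T}).

(* A new cycle uses xy; cutting it there leaves a path from x to y. *)
Lemma add_edge_path x y k : has_cycle (add_edge G x y) k -> ~~ has_cycle G k ->
  exists S, path_on G x y S /\ #|S| = k.
Proof.
rewrite /has_cycle => /andP[k2 /existsP[t /andP[ct ut]]]; rewrite k2 /= negb_exists.
move=> /forallP/(_ t); rewrite /ucycleb negb_and ut orbF => nt.
have st := size_tuple t; move: (tval t) st ct ut nt => {t} s sk cs us notG.
have newE u v : add_edge G x y u v -> ~~ G u v -> [set u; v] = [set x; y].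
  by rewrite /= => /orP[->//|/andP[_ /eqP]].
have : ~~ all (fun a => G (prev s a) a) s.
  (* Some step of the cycle is not an edge of [G]; the cycle is rotated to start right after it. *)
  apply: contra notG => /allP h; exact: cycle_from_prev.
case/allPn=> a as_ na.
have ga := prev_cycle cs as_.
case: (rot_to as_) => i q Eq.
have ua : uniq (a :: q) by rewrite -Eq rot_uniq.
have ca : cycle (add_edge G x y) (a :: q) by rewrite -Eq rot_cycle.
have {}sk : (size q).+1 = k by rewrite -sk -(size_rot i s) Eq.
have nl : nth a (a :: q) (size q) = last a q by rewrite -[size q]/(size (a :: q)).-1 nth_last.
have pa : prev s a = last a q.
  rewrite -(prev_rot i us) Eq prev_nth inE eqxx -nl.
  by move: ua => /= /andP[/memNindex -> _].
rewrite {}pa in na ga.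
have Exy := newE _ _ ga na.
(* A second new step would have the same two ends, so the first and last positions would be
   consecutive and the cycle would have length 2. *)
have pq : path G a q.
  move: ca => /=; rewrite rcons_path => /andP[/(pathP a) pq _]; apply/(pathP a) => j jq.
  apply/idPn => nj; have := newE _ _ (pq j jq) nj; rewrite -Exy => E.
  have nthq l : l <= size q -> nth a (a :: q) l \in [set nth a (a :: q) j; nth a q j] ->
      l = j \/ l = j.+1.
    move=> lq; rewrite -[nth a q j]/(nth a (a :: q) j.+1) !inE.
    by rewrite !nth_uniq //= ?ltnS // => [/orP[]/eqP|]; [left|right|exact: ltnW].
  have [] : size q = j \/ size q = j.+1.
  - by apply: nthq => //; rewrite E nl !inE eqxx.
  - arith.
  have := nthq 0 isT; rewrite E !inE eqxx orbT => /(_ isT); arith.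
have p : path_on G a (last a q) [set t in a :: q].
  by exists q; split => // t; rewrite inE.
have card_S : #|[set t in a :: q]| = k by rewrite cardsE (card_uniqP ua).
have nel : last a q != a by apply: contraTneq ga => ->; rewrite (adj_irr (add_edge G x y)).
exists [set t in a :: q]; split=> //.
have : x \in [set last a q; a] /\ y \in [set last a q; a] by rewrite Exy !inE !eqxx orbT.
have : last a q \in [set x; y] /\ a \in [set x; y] by rewrite -Exy !inE !eqxx orbT.
rewrite !inE => -[/orP[]/eqP el /orP[]/eqP ea] _.
- by rewrite el ea eqxx in nel.
- by rewrite -el -ea; apply: path_on_sym.
- by rewrite -el -ea.
- by rewrite el ea eqxx in nel.
Qed.

Lemma add_edge_sub x y : subrel G (add_edge G x y).
Proof. by move=> u v /= ->. Qed.

Lemma clique_subrel (L : sgraph T) A : subrel G L -> clique G A -> clique L A.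
Proof.
move=> sGL /cliqueP cA; apply/cliqueP => x y xA yA ne; exact/sGL/cA.
Qed.

Lemma connected_subrel (L : sgraph T) : subrel G L -> connected G -> connected L.
Proof.
move=> sGL /andP[T0 /connected_inP cG]; apply/andP; split=> //.
apply/connected_inP => x y xA yA.
apply: connect_sub (cG x y xA yA) => u v /and3P[uT vT uv]; apply: connect1.
by rewrite /in_rel /= uT vT sGL.
Qed.

Lemma num_cliques_subrel (L : sgraph T) s : subrel G L ->
  num_cliques G s <= num_cliques L s.
Proof.
move=> sGL; apply/subset_leq_card/subsetP => A; rewrite !inE /is_K.
by case/andP=> -> /(clique_subrel sGL) ->.
Qed.

End AddEdge.

Lemma edge_maximal_exists (T : finType) (G : sgraph T) c :
  circumference G <= c -> exists L, edge_maximal G c L.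
Proof.
move: {2}#|[set p : T * T | ~~ G p.1 p.2]| (leqnn #|[set p : T * T | ~~ G p.1 p.2]|) => n.
elim: n G => [|n IH] G hn cG.
  exists G; split=> // x y _ nG; have := hn; rewrite leqn0 cards_eq0 => /eqP E.
  by have := in_set0 (x, y); rewrite -E inE /= nG.
case: (boolP [exists x, exists y, [&& x != y, ~~ G x y & circumference (add_edge G x y) <= c]]).
  case/existsP=> x /existsP[y /and3P[ne nG cG']].
  have [|L [sL cL mL]] := IH (add_edge G x y) _ cG'.
    rewrite -ltnS; apply: leq_trans hn; apply: proper_card; apply/properP; split.
      by apply/subsetP => p; rewrite !inE; apply: contra => /(add_edge_sub x y).
    by exists (x, y); rewrite inE //= ne eqxx /= orbT.
  by exists L; split=> // u v /(add_edge_sub x y) /sL.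
rewrite negb_exists => /forallP no; exists G; split=> // x y ne nG.
have := no x; rewrite negb_exists => /forallP/(_ y).
by rewrite ne nG /= -ltnNge.
Qed.

(** * Block structure of a connected edge-maximal graph *)

Section Structure.
Variables (T : finType) (G L : sgraph T) (c s : nat).
Hypotheses (hs : 3 <= s) (hsc : s <= c) (mL : edge_maximal G c L) (cL : connected L).
Hypothesis T1 : 1 < #|T|.
Implicit Types (x y : T) (B S : {set T}).

Let c1 : 2 <= c. Proof. arith. Qed.

Lemma circ_L : circumference L <= c.
Proof. by case: mL. Qed.

(** A cycle longer than [c] in the graph with [xy] added leaves a path from [x] to [y], which cannot
    exit the block. *)
Lemma long_path_block B x y : B \in blocks L -> x \in B -> y \in B -> x != y ->
  ~~ L x y -> exists S, [/\ S \subset B, path_on L x y S & c < #|S|].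
Proof.
move=> bB xB yB ne nL; case: mL => _ cLc /(_ x y ne nL) /circ_has_cycle[k ck hk].
have [S [pS cS]] : exists S, path_on L x y S /\ #|S| = k.
  by apply: (add_edge_path hk); apply/negP => /has_cycle_circ; arith.
by exists S; split=> //; [exact: path_on_in_block bB xB yB ne pS | rewrite cS].
Qed.

Lemma small_block_clique B : B \in blocks L -> #|B| <= c -> clique L B.
Proof.
move=> bB hB; apply/cliqueP => x y xB yB ne; apply/idPn => nL.
have [S [/subset_leq_card sS _ cS]] := long_path_block bB xB yB ne nL; arith.
Qed.

Lemma block_size B : B \in blocks L -> 1 < #|B|.
Proof.
rewrite -blocks_inT; apply: block_in_card; last by rewrite cardsT.
by case/andP: cL.
Qed.

Lemma sum_blocks : \sum_(B in blocks L) (#|B| - 1) = #|T| - 1.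
Proof.
rewrite -blocks_inT blocks_in_sum ?cardsT //; first by case/andP: cL.
by rewrite -card_gt0 cardsT; arith.
Qed.

Lemma big_block_num_cliques B : B \in blocks L -> c < #|B| ->
  num_cliques_in L s B < max_cliques s c (#|B| - 1).
Proof.
move=> bB cb; have [[nB _]] := (blocksP _ _ bB).
have /nonseparableP[_ _ dB] := nB.
have [||r [k [rk kr rc k0 hk]]] :=
  block_bound dB c1 circ_L (fun x y => @long_path_block B x y bB) (s := s) _ _ cb; try arith.
exact: leq_ltn_trans hk (big_block_lt hs hsc cb rk kr rc k0).
Qed.

Lemma small_block_num_cliques B : B \in blocks L -> #|B| <= c ->
  num_cliques_in L s B = max_cliques s c (#|B| - 1).
Proof.
move=> bB hB; have h1 := block_size bB.
rewrite num_cliques_in_clique; last exact: small_block_clique.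
have [E|ne] := eqVneq #|B| c; first by rewrite E max_cliques_full.
by rewrite max_cliques_small ?subnK //; arith.
Qed.

Lemma block_num_cliques_le B : B \in blocks L -> num_cliques_in L s B <= max_cliques s c (#|B| - 1).
Proof.
move=> bB; have [hB|hB] := leqP #|B| c; first by rewrite small_block_num_cliques.
exact/ltnW/big_block_num_cliques.
Qed.

Lemma num_cliques_le : num_cliques L s <= max_cliques s c (#|T| - 1).
Proof.
rewrite num_cliques_blocks; last by arith.
rewrite -sum_blocks; apply: leq_trans (max_cliques_sum hs hsc _ _).
by apply: leq_sum => B /block_num_cliques_le.
Qed.

(** A block on more than [c] vertices would make the sum over the blocks strictly too small. So all
    blocks are complete, and [extremal_sizes] determines their sizes. *)
Lemma extremal_structure : num_cliques L s = max_cliques s c (#|T| - 1) ->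
  (forall B, B \in blocks L -> clique L B) /\
  #|[set B in blocks L | #|B| - 1 == c - 1]| = (#|T| - 1) %/ (c - 1) /\
  (s <= (#|T| - 1) %% (c - 1) + 1 -> exists B0,
    [set B in blocks L | #|B| - 1 != c - 1] = [set B0] /\
    #|B0| - 1 = (#|T| - 1) %% (c - 1)).
Proof.
rewrite num_cliques_blocks; last by arith.
move=> E.
have small B : B \in blocks L -> #|B| <= c.
  move=> bB; rewrite leqNgt; apply/negP => cb.
  have := @max_cliques_sum_lt s c hs hsc _ (blocks L) (fun B => #|B| - 1) B (num_cliques_in L s) bB.
  rewrite sum_blocks -E ltnn => h; suff: false by [].
  by apply: h; [exact: block_num_cliques_le | exact: big_block_num_cliques].
split; first by move=> B bB; apply: small_block_clique; rewrite ?small.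
apply: (extremal_sizes hs hsc _ sum_blocks).
  by move=> B bB; have := small B bB; have := block_size bB; arith.
rewrite -E; apply: eq_bigr => B bB;
by rewrite small_block_num_cliques ?small.
Qed.

End Structure.

(** * Transfer from the edge-maximal graph to the original one *)

Lemma h_max_cliques n c s : h s n c = max_cliques s c (n - 1).
Proof.
rewrite /h /max_cliques /rest /alpha; congr (_ + 'C(_ + 1, _)).
by have := divn_eq (n - 1) (c - 1); arith.
Qed.

Lemma restE n c : rest n c = (n - 1) %% (c - 1).
Proof. by rewrite /rest /alpha; have := divn_eq (n - 1) (c - 1); arith. Qed.

(** Any [s - 2] further vertices of [B] complete the pair; this is used to find every edge of [L]
    inside an [s]-clique. *)
Lemma clique_through (T : finType) (L : sgraph T) s (B : {set T}) x y :
  clique L B -> x \in B -> y \in B -> x != y -> 2 <= s <= #|B| ->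
  exists C : {set T}, [/\ is_K L s C, x \in C & y \in C].
Proof.
move=> cB xB yB ne hsB.
have cD : #|B| = #|B :\ x :\ y| + 2.
  by rewrite (cardsD1 x B) (cardsD1 y (B :\ x)) xB !inE eq_sym ne yB /=; arith.
have : 0 < 'C(#|B :\ x :\ y|, s - 2) by rewrite bin_gt0; arith.
rewrite -cards_draws => /card_gt0P[D]; rewrite inE => /andP[sD /eqP cDs].
have xD : x \notin D by apply/negP => /(subsetP sD); rewrite !inE eqxx andbF.
have yD : y \notin D by apply/negP => /(subsetP sD); rewrite !inE eqxx.
exists (x |: (y |: D)); rewrite !inE !eqxx !orbT; split=> //.
rewrite /is_K !cardsU1 !inE (negPf ne) (negPf xD) yD cDs.
apply/andP; split; first by apply/eqP => /=; arith.
apply: clique_sub cB; apply/subsetP => t /setU1P[->//|/setU1P[->//|/(subsetP sD)]].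
by rewrite !inE => /and3P[].
Qed.

Theorem theorem5 (n c s : nat) (hn : 3 <= n) (hs : 3 <= s) (hsc : s <= c)
    (T : finType) (G : sgraph T) (hT : #|T| = n) (hconn : connected G)
    (hcirc : circumference G <= c) (hN : num_cliques G s = h s n c) :
  (s <= rest n c + 1 ->
     exists (T' : finType) (H : sgraph T'), is_H n c H /\ isomorphic G H) /\
  (rest n c + 2 <= s ->
     forall L : sgraph T, edge_maximal G c L ->
       connected L /\
       exists A : {set {set T}},
         [/\ A \subset blocks L,
             #|A| = alpha n c,
             (forall B : {set T}, B \in A -> is_K L c B)
           & (forall B : {set T}, B \in blocks L :\: A -> clique L B)]).
Proof.
have T1 : 1 < #|T| by arith.
pose full (L : sgraph T) := [set B in blocks L | #|B| - 1 == c - 1].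
(* The count for [L] lies between that for [G] and [h s n c], which are equal. *)
have eqN L : edge_maximal G c L -> num_cliques L s = num_cliques G s.
  move=> mL; have [sGL _ _] := mL; have cL := connected_subrel sGL hconn.
  apply/eqP; rewrite eqn_leq (num_cliques_subrel _ sGL) andbT hN h_max_cliques -hT.
  exact: num_cliques_le mL cL T1.
have structure L : edge_maximal G c L -> [/\ connected L,
    forall B, B \in blocks L -> clique L B, #|full L| = alpha n c,
    forall B, B \in full L -> is_K L c B &
    s <= rest n c + 1 -> exists B0, [set B in blocks L | #|B| - 1 != c - 1] = [set B0] /\
      is_K L (rest n c + 1) B0].
  move=> mL; have [sGL _ _] := mL; have cL := connected_subrel sGL hconn.
  have [|cB [cA hR]] := extremal_structure hs hsc mL cL T1.
    by rewrite eqN // hN h_max_cliques hT.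
  split=> // [|B|]; first by rewrite cA hT.
    rewrite inE => /andP[bB /eqP hB]; rewrite /is_K cB // andbT.
    by have h1 := block_size cL T1 bB; apply/eqP; arith.
  rewrite restE -hT => /hR[B0 [E hB0]]; exists B0; split=> //.
  have : B0 \in [set B in blocks L | #|B| - 1 != c - 1] by rewrite E set11.
  rewrite inE => /andP[bB _]; rewrite /is_K cB // andbT -hB0.
  by have h1 := block_size cL T1 bB; apply/eqP; arith.
split=> [hr|_ L mL]; last first.
  have [cL cB cA kA _] := structure L mL; split=> //; exists (full L); split=> //.
    by apply/subsetP => B; rewrite inE => /andP[].
  by move=> B; rewrite inE => /andP[_ /cB].
(* An edge-maximal [L] itself serves as the extremal graph, and the identity as the isomorphism. *)
have [L mL] := edge_maximal_exists hcirc.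
have [cL cB cA kA hR] := structure L mL; have [B0 [E kB0]] := hR hr.
have EL : blocks L = B0 |: full L.
  apply/setP => B; rewrite in_setU -E; apply/idP/orP => [bB|[]/setIdP[]//].
  by have [h|h] := boolP (#|B| - 1 == c - 1); [right|left]; apply/setIdP.
exists T, L; split; last first.
  exists id; first by exists id.
  have [sGL _ _] := mL => x y; apply/idP/idP => [Lxy|]; last exact: sGL.
  have ne : x != y by apply: contraTneq Lxy => ->; rewrite adj_irr.
  have [B bB sB] := nonseparable_in_block (edge_nonseparable Lxy).
  have xB : x \in B by rewrite (subsetP sB) // !inE eqxx.
  have yB : y \in B by rewrite (subsetP sB) // !inE eqxx orbT.
  (* The block has [c] vertices, or [rest n c + 1] if it is [B0]. *)
  have hB : 2 <= s <= #|B|.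
    move: bB; rewrite EL => /setU1P[->|/kA]; first by case/andP: kB0 => /eqP -> _; arith.
    by case/andP => /eqP -> _; arith.
  have [C [kC xC yC]] := clique_through (cB B bB) xB yB ne hB.
  (* Every [s]-clique of [G] is one of [L], and the numbers agree. *)
  have EC : [set A | is_K G s A] = [set A | is_K L s A].
    apply/eqP; rewrite eqEcard; apply/andP; split; last by have := eqN L mL; rewrite /num_cliques => ->.
    by apply/subsetP => A; rewrite !in_set /is_K => /andP[-> /(clique_subrel sGL) ->].
  have : C \in [set A | is_K G s A] by rewrite EC inE.
  by rewrite inE => /andP[_ /cliqueP]; apply.
split=> //; split=> //; exists (full L); split=> //.
have -> : rest n c == 0 = false by apply/eqP; arith.
exists B0; split=> //; apply/negP; rewrite inE => /andP[_ h].
have : B0 \in [set B in blocks L | #|B| - 1 != c - 1] by rewrite E set11.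
by rewrite inE h andbF.
Qed.
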